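(* Let $c\in\Big\{\tfrac{2\sqrt2}{3},\ \tfrac{\sqrt6}{3},\ \sqrt{\tfrac{2(5-\sqrt5)}{15}}\Big\}$ and let $\boldsymbol{p}_1$ be a best $G^1$ quartic patch, i.e. a $G^1$-admissible quartic patch (in the sense of the context) that minimizes, among all $G^1$-admissible quartic patches for this $c$, the simplified radial error $d_s$ (or, alternatively, the radial error $d_r$). Let $R$ be the reflection of $\mathbb{R}^3$ over the plane through the origin, $\boldsymbol{v}_1$ and $\boldsymbol{v}_2$, and let $\boldsymbol{p}_2=R\,\boldsymbol{p}_1$. Then $\boldsymbol{p}_1$ and $\boldsymbol{p}_2$, which share the boundary curve $v\mapsto\boldsymbol{p}_1(0,v)=\boldsymbol{p}_2(0,v)$, $v\in[0,1]$, form a $G^2$ continuous spline patch.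
   Context: $\Delta=\{(u,v)\in\mathbb{R}^2:\ 0\le u,v\le 1,\ v\le 1-u\}$ and $\|\cdot\|$ is the Euclidean norm. Let $\boldsymbol{v}_0=(c,0,\sqrt{1-c^2})^T$, $\boldsymbol{v}_1=(-\tfrac12c,\tfrac{\sqrt3}{2}c,\sqrt{1-c^2})^T$, $\boldsymbol{v}_2=(-\tfrac12c,-\tfrac{\sqrt3}{2}c,\sqrt{1-c^2})^T$. A quartic patch with real parameters $\alpha,\beta,\gamma,\zeta,\xi$ is $\boldsymbol{p}:\Delta\to\mathbb{R}^3$, $\boldsymbol{p}(u,v)=\sum_{i+j+k=4}\frac{4!}{i!j!k!}u^iv^j(1-u-v)^k\,\boldsymbol{b}_{i,j,k}$ (with $i,j,k$ nonnegative integers), where $\boldsymbol{b}_{4,0,0}=\boldsymbol{v}_0$, $\boldsymbol{b}_{0,4,0}=\boldsymbol{v}_1$, $\boldsymbol{b}_{0,0,4}=\boldsymbol{v}_2$, $\boldsymbol{b}_{3,1,0}=\alpha\boldsymbol{v}_0+\beta\boldsymbol{v}_1$, $\boldsymbol{b}_{2,2,0}=\gamma(\boldsymbol{v}_0+\boldsymbol{v}_1)$, $\boldsymbol{b}_{2,1,1}=\zeta\boldsymbol{v}_0+\xi(\boldsymbol{v}_1+\boldsymbol{v}_2)$, and the remaining control points are obtained from these by symmetry, i.e. by applying the same permutation to the three index positions and to $(\boldsymbol{v}_0,\boldsymbol{v}_1,\boldsymbol{v}_2)$ (for instance $\boldsymbol{b}_{1,3,0}=\alpha\boldsymbol{v}_1+\beta\boldsymbol{v}_0$,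 $\boldsymbol{b}_{0,2,2}=\gamma(\boldsymbol{v}_1+\boldsymbol{v}_2)$, $\boldsymbol{b}_{1,2,1}=\zeta\boldsymbol{v}_1+\xi(\boldsymbol{v}_0+\boldsymbol{v}_2)$). The patch is called $G^1$-admissible if: (1) it is regular: $\partial_u\boldsymbol{p}$ and $\partial_v\boldsymbol{p}$ are linearly independent at every point of $\Delta$; (2) at each of the three vertices $\boldsymbol{v}_m$ of the patch, the normal of the tangent plane of the patch is parallel to $\boldsymbol{v}_m$; (3) at every point of each of the three boundary curves of the patch, the normal $\partial_u\boldsymbol{p}\times\partial_v\boldsymbol{p}$ lies in the plane through the origin and the two endpoints of that boundary curve. Errors: $d_s(\boldsymbol{p})=\max_{(u,v)\in\Delta}\big|\|\boldsymbol{p}(u,v)\|^2-1\big|$ and $d_r(\boldsymbol{p})=\max_{(u,v)\in\Delta}\big|\|\boldsymbol{p}(u,v)\|-1\big|$. $G^k$ continuity: a map $\boldsymbol{q}:D\to\mathbb{R}^3$ on an open set $D\subset\mathbb{R}^2$ is $G^k$ continuous if for each $\boldsymbol{x}\in D$ there are an open neighbourhood $D_{\boldsymbol{x}}\subseteq D$ of $\boldsymbol{x}$ and a homeomorphism $\boldsymbol{\rho}_{\boldsymbol{x}}:B^2\to D_{\boldsymbol{x}}$ from an open ball $B^2\subset\mathbb{R}^2$ such that $\boldsymbol{q}\circ\boldsymbol{\rho}_{\boldsymbol{x}}$ is $C^k$ and regular (its differential has rank $2$ everywhere). Two polynomial patches $\boldsymbol{p}_1,\boldsymbol{p}_2$ on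 $\Delta$ with $\boldsymbol{p}_1(0,v)=\boldsymbol{p}_2(0,v)$ form a $G^k$ continuous spline patch if, on some open neighbourhood of $\Delta_1\cup\Delta_2$, where $\Delta_1=\Delta$ and $\Delta_2=\{(-u,v):(u,v)\in\Delta\}$, the map $\boldsymbol{q}$ given by $\boldsymbol{q}(u,v)=\boldsymbol{p}_1(u,v)$ for $u\ge0$ and $\boldsymbol{q}(u,v)=\boldsymbol{p}_2(-u,v)$ for $u<0$ (the polynomials being extended by their formulas) is $G^k$ continuous. *)

(* Defs.v *)
From HB Require Import structures.
From mathcomp Require Import all_boot all_order all_algebra.
From mathcomp Require Import all_classical all_reals all_analysis.

Set Implicit Arguments.
Unset Strict Implicit.
Unset Printing Implicit Defensive.

Import Order.TTheory GRing.Theory Num.Theory numFieldNormedType.Exports.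

Local Open Scope classical_set_scope.
Local Open Scope ring_scope.

Section Euclidean.
Context {R : realType}.

Definition pt2 (a b : R) : 'rV[R]_2 := \row_j [:: a; b]`_j.
Definition pt3 (a b c : R) : 'rV[R]_3 := \row_j [:: a; b; c]`_j.

Definition dot n (x y : 'rV[R]_n) : R := \sum_i x 0 i * y 0 i.

(* The library norm on 'rV[R]_n is the sup norm: it induces the same topology,
   but the Euclidean norm is needed for the errors. *)
Definition enorm n (x : 'rV[R]_n) : R := Num.sqrt (dot x x).

Definition eball n (a : 'rV[R]_n) (r : R) : set 'rV[R]_n :=
  [set x | enorm (x - a) < r].

Definition cross (x y : 'rV[R]_3) : 'rV[R]_3 :=
  pt3 (x 0 1 * y 0 2 - x 0 2 * y 0 1)
      (x 0 2 * y 0 0 - x 0 0 * y 0 2)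
      (x 0 0 * y 0 1 - x 0 1 * y 0 0).

(* Reflection over the plane spanned by two independent vectors a and b. *)
Definition reflection (a b x : 'rV[R]_3) : 'rV[R]_3 :=
  let n := cross a b in x - (2 * dot x n / dot n n) *: n.

End Euclidean.

Section Patches.
Context {R : realType}.
Implicit Types (c : R) (p q : 'rV[R]_2 -> 'rV[R]_3).

(* The parameter pair (u, v) is a row vector, with u = x 0 0 and v = x 0 1. *)
Definition Delta : set 'rV[R]_2 :=
  [set x | [/\ 0 <= x 0 0 <= 1, 0 <= x 0 1 <= 1 & x 0 1 <= 1 - x 0 0]].

Definition vertex0 c : 'rV[R]_3 := pt3 c 0 (Num.sqrt (1 - c ^+ 2)).
Definition vertex1 c : 'rV[R]_3 :=
  pt3 (- (1 / 2) * c) (Num.sqrt 3 / 2 * c) (Num.sqrt (1 - c ^+ 2)).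
Definition vertex2 c : 'rV[R]_3 :=
  pt3 (- (1 / 2) * c) (- (Num.sqrt 3 / 2) * c) (Num.sqrt (1 - c ^+ 2)).

Definition control_point c (alpha beta gamma zeta xi : R) (i j k : nat) :
    'rV[R]_3 :=
  let v0 := vertex0 c in let v1 := vertex1 c in let v2 := vertex2 c in
  match (i, j, k) with
  | (4, 0, 0)%N => v0
  | (0, 4, 0)%N => v1
  | (0, 0, 4)%N => v2
  | (3, 1, 0)%N => alpha *: v0 + beta *: v1
  | (3, 0, 1)%N => alpha *: v0 + beta *: v2
  | (1, 3, 0)%N => alpha *: v1 + beta *: v0
  | (0, 3, 1)%N => alpha *: v1 + beta *: v2
  | (1, 0, 3)%N => alpha *: v2 + beta *: v0
  | (0, 1, 3)%N => alpha *: v2 + beta *: v1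
  | (2, 2, 0)%N => gamma *: (v0 + v1)
  | (2, 0, 2)%N => gamma *: (v0 + v2)
  | (0, 2, 2)%N => gamma *: (v1 + v2)
  | (2, 1, 1)%N => zeta *: v0 + xi *: (v1 + v2)
  | (1, 2, 1)%N => zeta *: v1 + xi *: (v0 + v2)
  | (1, 1, 2)%N => zeta *: v2 + xi *: (v0 + v1)
  | _ => 0
  end.

(* Defined on the whole plane by its formula, so that the partial derivatives
   at boundary points of Delta are those of the polynomial. *)
Definition quartic_patch c (alpha beta gamma zeta xi : R) (x : 'rV[R]_2) :
    'rV[R]_3 :=
  let u := x 0 0 in let v := x 0 1 in
  \sum_(i < 5) \sum_(j < 5 | (i + j <= 4)%N)
    let k := (4 - i - j)%N in
    (4`!%:R / (i`! * j`! * k`!)%:R * u ^+ i * v ^+ j * (1 - u - v) ^+ k)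
      *: control_point c alpha beta gamma zeta xi i j k.

Definition is_quartic_patch c p : Prop :=
  exists alpha beta gamma zeta xi : R,
    p = quartic_patch c alpha beta gamma zeta xi.

Definition partial n (f : 'rV[R]_2 -> 'rV[R]_n) (i : 'I_2) (x : 'rV[R]_2) :
  'rV[R]_n := 'D_(delta_mx 0 i) f x.

Definition patch_normal p (x : 'rV[R]_2) : 'rV[R]_3 :=
  cross (partial p 0 x) (partial p 1 x).

Definition regular_patch p : Prop :=
  forall x, Delta x -> free [:: partial p 0 x; partial p 1 x].

Definition parallel (x y : 'rV[R]_3) : Prop := exists l : R, x = l *: y.

Definition in_plane (a b x : 'rV[R]_3) : Prop :=
  exists l m : R, x = l *: a + m *: b.

(* The vertices v0, v1, v2 are attained at (1, 0), (0, 1), (0, 0). *)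
Definition G1_admissible c p : Prop :=
  [/\ regular_patch p,
      [/\ parallel (patch_normal p (pt2 1 0)) (vertex0 c),
          parallel (patch_normal p (pt2 0 1)) (vertex1 c)
        & parallel (patch_normal p (pt2 0 0)) (vertex2 c)]
    & forall t : R, 0 <= t <= 1 ->
      [/\ in_plane (vertex0 c) (vertex1 c) (patch_normal p (pt2 t (1 - t))),
          in_plane (vertex0 c) (vertex2 c) (patch_normal p (pt2 t 0))
        & in_plane (vertex1 c) (vertex2 c) (patch_normal p (pt2 0 t))]].

(* Delta is compact, so for a continuous p these suprema are maxima. *)
Definition simplified_radial_error p : R :=
  sup [set `|enorm (p x) ^+ 2 - 1| | x in Delta].

Definition radial_error p : R :=
  sup [set `|enorm (p x) - 1| | x in Delta].

Definition best_G1_patch c (err : ('rV[R]_2 -> 'rV[R]_3) -> R) p : Prop :=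
  [/\ is_quartic_patch c p, G1_admissible c p
    & forall q, is_quartic_patch c q -> G1_admissible c q -> err p <= err q].

End Patches.

Section Continuity.
Context {R : realType}.

Fixpoint Ck n (k : nat) (U : set 'rV[R]_2) (f : 'rV[R]_2 -> 'rV[R]_n) : Prop :=
  match k with
  | 0%N => forall x, U x -> {for x, continuous f}
  | k'.+1 => (forall x, U x -> differentiable f x) /\
             (forall i : 'I_2, Ck k' U (partial f i))
  end.

Definition homeomorphism (A B : set 'rV[R]_2) (f : 'rV[R]_2 -> 'rV[R]_2) :
    Prop :=
  [/\ set_bij A B f, {within A, continuous f}
    & exists2 g : 'rV[R]_2 -> 'rV[R]_2,
        {within B, continuous g} & forall x, A x -> g (f x) = x].

Definition regular_on (U : set 'rV[R]_2) (f : 'rV[R]_2 -> 'rV[R]_3) : Prop :=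
  forall x, U x -> differentiable f x /\ \rank ('J f x) = 2%N.

Definition Gk_continuous (k : nat) (D : set 'rV[R]_2)
    (q : 'rV[R]_2 -> 'rV[R]_3) : Prop :=
  forall x, D x -> exists (Dx : set 'rV[R]_2) (a : 'rV[R]_2) (r : R)
      (rho : 'rV[R]_2 -> 'rV[R]_2),
    [/\ open Dx, Dx x & Dx `<=` D] /\
    [/\ 0 < r, homeomorphism (eball a r) Dx rho,
        Ck k (eball a r) (q \o rho) & regular_on (eball a r) (q \o rho)].

Definition mirror (x : 'rV[R]_2) : 'rV[R]_2 := pt2 (- x 0 0) (x 0 1).

Definition glue (p1 p2 : 'rV[R]_2 -> 'rV[R]_3) (x : 'rV[R]_2) : 'rV[R]_3 :=
  if 0 <= x 0 0 then p1 x else p2 (mirror x).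

Definition Gk_spline_patch (k : nat) (p1 p2 : 'rV[R]_2 -> 'rV[R]_3) : Prop :=
  (forall v : R, 0 <= v <= 1 -> p1 (pt2 0 v) = p2 (pt2 0 v)) /\
  exists D : set 'rV[R]_2,
    [/\ open D, Delta `|` (mirror @` Delta) `<=` D
      & Gk_continuous k D (glue p1 p2)].

End Continuity.

(* Main.v *)
Require Import Defs.
From mathcomp Require Import all_boot all_order all_algebra.
From mathcomp Require Import all_classical all_reals all_analysis.
From mathcomp Require Import ring lra.

Set Implicit Arguments.
Unset Strict Implicit.
Unset Printing Implicit Defensive.

Import Order.TTheory GRing.Theory Num.Theory numFieldNormedType.Exports.

Local Open Scope classical_set_scope.
Local Open Scope ring_scope.

(* Let n be the normal of the mirror plane and q = <p, n>.  On the common boundary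
   u = 0 one has q = 0, and the admissibility condition says that the tangent plane
   contains n, so that p_u - b p_v = l n for a rational function b of v.  Since the
   second patch is the mirror image of the first, the union of the two is locally
   the graph, over the plane spanned by n and the boundary tangent, of an even
   function with vanishing normal derivative, and such a function is C^2.
   To avoid the inverse function theorem in the regularity argument, the graph
   parametrization is replaced by the explicit one
     u = s + m(t) s^2,  v = t - b(t) u  for s >= 0, extended by mirror symmetry,
   where m is chosen so that q has no s^2 term.  Only the continuity of its inverse
   is then needed, and it is a composition of two shears.  The boundary condition
   extends from [0, 1] to the whole line because it is polynomial. *)

(** * Differentiability and smoothness of functions on the plane *)

Section LocalDifferentiability.
Context {R : realType}.

(** [Gk_continuous] asks only that the chart be a homeomorphism; smoothness and rank are required of
    the composite alone. The chart may therefore have a kink along the common boundary: mirror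
    symmetry puts [|u|] into it, and this kink cancels the one of [glue]. After reparametrization
    the component along [n] is continued as an odd function of [s], the components orthogonal to [n]
    as even ones. An odd continuation is C^2 when its value and its second normal derivative vanish
    on the line, an even one when its first normal derivative vanishes there. The coefficient [b]
    settles the even part and [m] the odd part. Both coefficients are quotients, with denominators
    [|p_v|^2] and [q_u]. Regularity together with the boundary condition on the normal makes these
    nonzero: if [q_u] vanished, [p_u] would be a multiple of [p_v]. Regularity is measured by a Gram
    determinant, because it is continuous and is invariant under both the reflection and the shear
    by [b]. *)

Lemma differentiable_local (V W : normedModType R) (f : V -> W)
    (L : {linear V -> W}) (x : V) :
  continuous L ->
  (forall e, 0 < e -> \forall h \near 0, `|f (h + x) - f x - L h| <= e * `|h|) ->
  differentiable f x /\ 'd f x = L :> (V -> W).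
Proof.
move=> cL fL.
have fo : f \o shift x = cst (f x) + L +o_ 0 id.
  apply/eqaddoP => e e0; apply: filterS (fL e e0) => h /=.
  by rewrite /GRing.add /GRing.opp /= opprD addrA.
have dL := diff_unique cL fo.
by split=> //; apply/diff_locallyP; rewrite dL.
Qed.

Lemma differentiable_remainder (V W : normedModType R) (f : V -> W) (x : V) :
  differentiable f x -> forall e, 0 < e ->
  \forall h \near 0, `|f (h + x) - f x - 'd f x h| <= e * `|h|.
Proof.
move=> /diff_locallyP [_ /eqaddoP fo] e e0; apply: filterS (fo e e0) => h /=.
by rewrite /GRing.add /GRing.opp /= opprD addrA.
Qed.

Lemma near_eq_differentiable (V W : normedModType R) (f g : V -> W) (x : V) :
  {near x, f =1 g} -> differentiable f x -> differentiable g x.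
Proof.
move=> fg df; have fgx := nbhs_singleton fg.
apply: (proj1 (@differentiable_local _ _ g ('d f x) x _ _)).
  exact: diff_continuous.
move=> e e0; have := differentiable_remainder df e0.
move: fg; rewrite (near_shift 0) /= => fg; apply: filterS2 fg => h.
by rewrite /= subr0 fgx => ->.
Qed.

End LocalDifferentiability.

Section SmoothFunctions.
Context {R : realType}.
Notation V2 := 'rV[R]_2.
Implicit Types (f g : V2 -> R) (U : set V2) (x : V2) (k : nat) (i : 'I_2).

Definition pd i f : V2 -> R := fun x => 'D_(delta_mx 0 i) f x.

(** Scalar counterpart of [Ck], since the product, inverse and chain rules act on real functions;
    [Ck_coord] passes back to vectors. *)
Fixpoint smooth k U f : Prop :=
  match k with
  | 0%N => forall x, U x -> {for x, continuous f}
  | k'.+1 => (forall x, U x -> differentiable f x) /\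
             (forall i, smooth k' U (pd i f))
  end.

Lemma pd_near i f g x : {near x, f =1 g} -> pd i f x = pd i g x.
Proof. exact: near_eq_derive. Qed.

Lemma eq_on_near (T : topologicalType) (Y : Type) (U : set T) (f g : T -> Y) (x : T) :
  open U -> {in U, f =1 g} -> U x -> {near x, f =1 g}.
Proof.
move=> oU fg Ux; apply: filterS (open_nbhs_nbhs (conj oU Ux)) => y Uy.
exact/fg/mem_set.
Qed.

Lemma pd_eq_on i U f g : open U -> {in U, f =1 g} -> {in U, pd i f =1 pd i g}.
Proof.
by move=> oU fg x /set_mem Ux; apply/pd_near/(eq_on_near oU fg Ux).
Qed.

Lemma smooth_eq k U f g : open U -> {in U, f =1 g} -> smooth k U f ->
  smooth k U g.
Proof.
move=> oU; elim: k f g => [|k IH] f g fg /=.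
  move=> cf x Ux; have nfg := eq_on_near oU fg Ux.
  rewrite /prop_for /continuous_at -(nbhs_singleton nfg).
  exact: cvg_trans (near_eq_cvg nfg) (cf x Ux).
case=> df sf; split=> [x Ux|i].
  exact: near_eq_differentiable (eq_on_near oU fg Ux) (df x Ux).
exact: (IH (pd i f) (pd i g) (pd_eq_on i oU fg) (sf i)).
Qed.

Lemma smooth_continuous k U f x : smooth k U f -> U x -> {for x, continuous f}.
Proof.
case: k => [|k] /=; first by move=> cf Ux; apply: cf.
by case=> df _ Ux; apply: differentiable_continuous; apply: df.
Qed.

Lemma smoothS k U f : smooth k.+1 U f -> smooth k U f.
Proof.
elim: k f => [|k IH] f sf; first by move=> x Ux; apply: smooth_continuous sf Ux.
case: sf => df sf; split=> // i; exact: IH _ (sf i).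
Qed.

Lemma smooth_sub k U U' f : U' `<=` U -> smooth k U f -> smooth k U' f.
Proof.
move=> UU; elim: k f => [|k IH] f /=; first by move=> cf x /UU; apply: cf.
by case=> df sf; split=> [x /UU|i]; [apply: df|apply: IH].
Qed.

Lemma pd_cst i (c : R) x : pd i (fun=> c) x = 0.
Proof. exact: derive_cst. Qed.

Lemma smooth_cst k U (c : R) : smooth k U (fun=> c).
Proof.
elim: k c => [|k IH] c /=; first by move=> x _; exact: cst_continuous.
split=> [x _|i]; first exact: differentiable_cst.
by rewrite (_ : pd i _ = fun=> 0) //; apply/funext => x; apply: pd_cst.
Qed.

Lemma pd_coord i (j : 'I_2) x : pd i (fun y => y 0 j) x = (i == j)%:R.
Proof.
have := derive_id x (delta_mx 0 i : V2); rewrite derive_mx; last exact: derivable_id.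
by move/rowP/(_ j); rewrite !mxE eqxx eq_sym.
Qed.

Lemma smooth_coord k U (j : 'I_2) : smooth k U (fun y => y 0 j).
Proof.
case: k => [|k] /=; first by move=> x _; apply: coord_continuous.
split=> [x _|i]; first exact: differentiable_coord.
rewrite (_ : pd i _ = fun=> (i == j)%:R); first exact: smooth_cst.
by apply/funext => x; apply: pd_coord.
Qed.

Lemma derivable_pd i f x : differentiable f x -> derivable f x (delta_mx 0 i).
Proof. exact: diff_derivable. Qed.

Lemma pdD i f g x : differentiable f x -> differentiable g x ->
  pd i (fun y => f y + g y) x = pd i f x + pd i g x.
Proof.
move=> df dg.
by rewrite /pd (deriveD (derivable_pd (i:=i) df) (derivable_pd (i:=i) dg)).
Qed.

Lemma pdM i f g x : differentiable f x -> differentiable g x ->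
  pd i (fun y => f y * g y) x = pd i f x * g x + f x * pd i g x.
Proof.
move=> df dg; rewrite /pd (deriveM (derivable_pd (i:=i) df) (derivable_pd (i:=i) dg)).
by rewrite addrC /GRing.scale /= mulrC.
Qed.

Lemma pdZ i (c : R) f x : differentiable f x ->
  pd i (fun y => c * f y) x = c * pd i f x.
Proof. by move=> df; rewrite /pd (deriveMl _ (derivable_pd (i:=i) df)). Qed.

Lemma pdV i f x : differentiable f x -> f x != 0 ->
  pd i (fun y => (f y)^-1) x = - ((f x)^-1 * (f x)^-1 * pd i f x).
Proof.
move=> df f0; rewrite /pd (deriveV f0 (derivable_pd (i:=i) df)).
by rewrite /GRing.scale /= -exprVn expr2 mulNr.
Qed.

Lemma smoothD k U f g : open U -> smooth k U f -> smooth k U g ->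
  smooth k U (fun x => f x + g x).
Proof.
move=> oU; elim: k f g => [|k IH] f g.
  by move=> cf cg x Ux; exact: (cvgD (cf x Ux) (cg x Ux)).
case=> df sf [dg sg]; split=> [x Ux|i].
  by apply: differentiableD; [apply: df|apply: dg].
apply: (smooth_eq oU) (IH _ _ (sf i) (sg i)) => x /set_mem Ux.
by rewrite pdD//; [apply: df|apply: dg].
Qed.

Lemma smoothM k U f g : open U -> smooth k U f -> smooth k U g ->
  smooth k U (fun x => f x * g x).
Proof.
move=> oU; elim: k f g => [|k IH] f g sf sg.
  by move=> x Ux; exact: (cvgM (sf x Ux) (sg x Ux)).
have [[df pf] [dg pg]] := (sf, sg); split=> [x Ux|i].
  by apply: differentiableM; [apply: df|apply: dg].
have := smoothD oU (IH _ _ (pf i) (smoothS sg)) (IH _ _ (smoothS sf) (pg i)).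
apply: (smooth_eq oU) => x /set_mem Ux.
by rewrite pdM//; [apply: df|apply: dg].
Qed.

Lemma smoothZ k U (c : R) f : open U -> smooth k U f ->
  smooth k U (fun x => c * f x).
Proof. by move=> oU; apply: smoothM => //; apply: smooth_cst. Qed.

Lemma smoothN k U f : open U -> smooth k U f -> smooth k U (fun x => - f x).
Proof.
by move=> oU /(smoothZ (-1) oU); apply: smooth_eq => // x _; rewrite mulN1r.
Qed.

Lemma smoothB k U f g : open U -> smooth k U f -> smooth k U g ->
  smooth k U (fun x => f x - g x).
Proof. by move=> oU sf sg; apply: smoothD => //; apply: smoothN. Qed.

Lemma smoothV k U f : open U -> (forall x, U x -> f x != 0) -> smooth k U f ->
  smooth k U (fun x => (f x)^-1).
Proof.
move=> oU f0; elim: k => [|k IH] sf.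
  by move=> x Ux; exact: (cvgV (f0 x Ux) (sf x Ux)).
have [df pf] := sf; split=> [x Ux|i].
  by apply: differentiableV; [apply: df|apply: f0].
have iV := IH (smoothS sf).
have := smoothN oU (smoothM oU (smoothM oU iV iV) (pf i)).
apply: (smooth_eq oU) => x /set_mem Ux.
by rewrite pdV//; [apply: df|apply: f0].
Qed.

Lemma pt2E (a b : R) : pt2 a b = a *: delta_mx 0 0 + b *: delta_mx 0 1.
Proof.
apply/rowP => j; rewrite !mxE /=.
by case: j => [[|[|//]] ?] /=; rewrite ?mulr1 ?mulr0 ?addr0 ?add0r.
Qed.

Lemma pt2_0 (a b : R) : pt2 a b 0 0 = a. Proof. by rewrite mxE. Qed.
Lemma pt2_1 (a b : R) : pt2 a b 0 1 = b. Proof. by rewrite mxE. Qed.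

Lemma pt2_eta x : pt2 (x 0 0) (x 0 1) = x.
Proof.
apply/rowP => j; rewrite mxE.
by case: j => [[|[|//]] ?] /=; congr (x _ _); apply: val_inj.
Qed.

Lemma pt2_continuous (T : topologicalType) (a b : T -> R) (t : T) :
  {for t, continuous a} -> {for t, continuous b} ->
  {for t, continuous (fun t => pt2 (a t) (b t))}.
Proof.
move=> ca cb; rewrite (_ : (fun _ => _) =
  fun t => a t *: delta_mx 0 0 + b t *: delta_mx 0 1).
  exact: (cvgD (cvgZr_tmp ca) (cvgZr_tmp cb)).
by apply/funext => s; rewrite pt2E.
Qed.

Lemma diff_pt2 (r0 r1 : V2 -> R) x : differentiable r0 x -> differentiable r1 x ->
  differentiable (fun y => pt2 (r0 y) (r1 y)) x /\
  forall v, 'd (fun y => pt2 (r0 y) (r1 y)) x v = pt2 ('d r0 x v) ('d r1 x v).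
Proof.
move=> d0 d1.
pose A y := r0 y *: (delta_mx 0 0 : V2); pose B y := r1 y *: (delta_mx 0 1 : V2).
have -> : (fun y => pt2 (r0 y) (r1 y)) = A + B by apply/funext => y; rewrite pt2E.
have dA : differentiable A x by exact: differentiableZl.
have dB : differentiable B x by exact: differentiableZl.
split=> [|v]; first exact: differentiableD.
have := congr1 (fun h : V2 -> V2 => h v) (diffD dA dB) => /= ->.
have hA : 'd A x v = 'd r0 x v *: delta_mx 0 0 by rewrite /A diffZl.
have hB : 'd B x v = 'd r1 x v *: delta_mx 0 1 by rewrite /B diffZl.
by rewrite pt2E -hA -hB.
Qed.

Lemma differentiable_comp2 f (r0 r1 : V2 -> R) x :
  differentiable r0 x -> differentiable r1 x ->
  differentiable f (pt2 (r0 x) (r1 x)) ->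
  differentiable (fun y => f (pt2 (r0 y) (r1 y))) x.
Proof.
move=> d0 d1 df; apply: (differentiable_comp (proj1 (diff_pt2 d0 d1)) df).
Qed.

Lemma linear_pt2 (L : {linear V2 -> R}) (a b : R) :
  L (pt2 a b) = a * L (delta_mx 0 0) + b * L (delta_mx 0 1).
Proof. by rewrite pt2E linearD !linearZ. Qed.

Lemma pd_comp i f (r0 r1 : V2 -> R) x :
  differentiable r0 x -> differentiable r1 x ->
  differentiable f (pt2 (r0 x) (r1 x)) ->
  pd i (fun y => f (pt2 (r0 y) (r1 y))) x =
  pd i r0 x * pd 0 f (pt2 (r0 x) (r1 x)) + pd i r1 x * pd 1 f (pt2 (r0 x) (r1 x)).
Proof.
move=> d0 d1 df; rewrite /pd deriveE; last exact: differentiable_comp2.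
have [d dE] := diff_pt2 d0 d1.
have /= -> := diff_comp d df.
rewrite /= dE linear_pt2.
by congr (_ * _ + _ * _); rewrite deriveE.
Qed.

(** Induction on [k] with [f] generalized: by the chain rule each partial is a sum of terms
    [pd j f], composed with the same [r0] and [r1], times a partial of [r0] or [r1]. *)
Lemma smooth_comp k U W f (r0 r1 : V2 -> R) : open U ->
  (forall x, U x -> W (pt2 (r0 x) (r1 x))) ->
  smooth k W f -> smooth k U r0 -> smooth k U r1 ->
  smooth k U (fun y => f (pt2 (r0 y) (r1 y))).
Proof.
move=> oU UW; elim: k f => [|k IH] f sf s0 s1.
  move=> x Ux; apply: continuous_comp; last exact: sf (UW _ Ux).
  by apply: pt2_continuous; [apply: s0|apply: s1].
have [[df pf] [d0 p0] [d1 p1]] := And3 sf s0 s1.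
have ih j := IH _ (pf j) (smoothS s0) (smoothS s1).
split=> [x Ux|i].
  by apply: differentiable_comp2; [apply: d0|apply: d1|apply/df/UW].
have := smoothD oU (smoothM oU (p0 i) (ih 0)) (smoothM oU (p1 i) (ih 1)).
apply: (smooth_eq oU) => x /set_mem Ux.
by rewrite pd_comp //; [apply: d0|apply: d1|apply/df/UW].
Qed.

End SmoothFunctions.

(** * Reduction of vector-valued maps to their coordinates *)

Section VectorValued.
Context {R : realType}.
Notation V2 := 'rV[R]_2.
Implicit Types (f g : V2 -> R) (U : set V2) (x : V2) (k : nat) (i : 'I_2).

Lemma row_fun_sum n (f : V2 -> 'rV[R]_n) :
  f = \sum_(j < n) (fun x => f x 0 j *: (delta_mx 0 j : 'rV[R]_n)).
Proof.
by apply/funext => x; rewrite fct_sumE {1}(row_sum_delta (f x)).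
Qed.

Lemma differentiable_row n (f : V2 -> 'rV[R]_n) x :
  (forall j, differentiable (fun y => f y 0 j) x) -> differentiable f x.
Proof.
move=> df; rewrite (row_fun_sum f); apply: differentiable_sum => j.
exact: differentiableZl.
Qed.

Lemma continuous_row n (f : V2 -> 'rV[R]_n) x :
  (forall j, {for x, continuous (fun y => f y 0 j)}) -> {for x, continuous f}.
Proof.
move=> cf; rewrite (row_fun_sum f).
elim/big_ind: _ => [|g h cg ch|j _]; first exact: cst_continuous.
  exact: (cvgD cg ch).
exact: (cvgZr_tmp (cf j)).
Qed.

Lemma partial_coord n (f : V2 -> 'rV[R]_n) i x j : differentiable f x ->
  partial f i x 0 j = pd i (fun y => f y 0 j) x.
Proof.
by move=> df; rewrite /partial derive_mx ?mxE//; exact: diff_derivable.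
Qed.

Lemma Ck_coord n k U (f : V2 -> 'rV[R]_n) : open U ->
  (forall j, smooth k U (fun x => f x 0 j)) -> Ck k U f.
Proof.
move=> oU; elim: k f => [|k IH] f sf /=.
  by move=> x Ux; apply: continuous_row => j; apply: sf.
have df x : U x -> differentiable f x.
  by move=> Ux; apply: differentiable_row => j; have [df _] := sf j; apply: df.
split=> // i; apply: IH => j; have [_ /(_ i)] := sf j.
by apply: smooth_eq => // x /set_mem Ux; rewrite partial_coord //; apply: df.
Qed.

Lemma Ck_sub n k U U' (f : V2 -> 'rV[R]_n) : U' `<=` U -> Ck k U f -> Ck k U' f.
Proof.
move=> UU; elim: k f => [|k IH] f /=; first by move=> cf x /UU; apply: cf.
by case=> df sf; split=> [x /UU|i]; [apply: df|apply: IH].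
Qed.

Lemma Ck_eq n k U (f g : V2 -> 'rV[R]_n) : open U -> {in U, f =1 g} ->
  Ck k U f -> Ck k U g.
Proof.
move=> oU; elim: k f g => [|k IH] f g fg /=.
  move=> cf x Ux; have nfg := eq_on_near oU fg Ux.
  rewrite /prop_for /continuous_at -(nbhs_singleton nfg).
  exact: cvg_trans (near_eq_cvg nfg) (cf x Ux).
case=> df sf; split=> [x Ux|i].
  exact: near_eq_differentiable (eq_on_near oU fg Ux) (df x Ux).
apply: (IH (partial f i) (partial g i)) (sf i) => x /set_mem Ux.
by apply: near_eq_derive; apply: eq_on_near oU fg Ux.
Qed.

End VectorValued.

(** * Mean value theorem along a segment *)

Section Schwarz.
Context {R : realType} {V : normedModType R}.
Implicit Types (f : V -> R) (x u v : V).

Lemma is_derive_line f x v (t : R) : differentiable f (x + t *: v) ->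
  is_derive t (1 : R) (fun s => f (x + s *: v)) ('D_v f (x + t *: v)).
Proof.
move=> df.
have dl : is_diff t (fun s : R => x + s *: v) (fun s => s *: v).
  have -> : (fun s : R => x + s *: v) = cst x + *:%R^~ v by [].
  by apply: is_diff_eq; rewrite add0r.
case: dl => dl dlE.
have dc : differentiable (f \o (fun s : R => x + s *: v)) t.
  by apply: differentiable_comp; [exact: dl|exact: df].
apply: DeriveDef; first exact: diff_derivable.
rewrite (deriveE _ dc) diff_comp //=.
by rewrite dlE scale1r deriveE.
Qed.

Lemma MVT_line f x v (h : R) : 0 <= h ->
  (forall t, 0 <= t <= h -> differentiable f (x + t *: v)) ->
  exists2 t, 0 <= t <= h & f (x + h *: v) - f x = 'D_v f (x + t *: v) * h.
Proof.
move=> h0 df.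
have [||c] := @MVT_segment R (fun s => f (x + s *: v))
    (fun t => 'D_v f (x + t *: v)) 0 h h0.
- move=> t; rewrite in_itv /= => /andP[t0 th].
  by apply: is_derive_line; apply: df; rewrite !ltW.
- apply: derivable_within_continuous => t; rewrite in_itv /= => th.
  by have := is_derive_line (df _ th) => -[].
by rewrite in_itv /= => ch; rewrite scale0r addr0 subr0; exists c.
Qed.

End Schwarz.

(** * Symmetry of second derivatives *)

Section SymmetryOfDerivatives.
Context {R : realType} {V : normedModType R}.
Implicit Types (f : V -> R) (x u v : V) (U : set V).

Lemma half_lt (t h r : R) : t + h = r / 2 -> 0 < h -> 0 < r -> t < r.
Proof. lra. Qed.

Lemma dist_lt_common (p q s t e : R) :
  `|p - s| < e -> `|q - t| < e -> s = t -> `|p - q| < e + e.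
Proof.
move=> ps qt st; rewrite -(subrKA s) (le_lt_trans (ler_normD _ _)) // ltrD //.
by rewrite distrC st.
Qed.

(** The mean value theorem is applied twice: to the increment [g] of [f] in direction [v], along
    [u], and then to ['D_u f] along [v]. *)
Lemma second_difference f x u v U (h : R) : 0 <= h ->
  (forall a b, 0 <= a <= h -> 0 <= b <= h -> U (x + a *: u + b *: v)) ->
  (forall y, U y -> differentiable f y) ->
  (forall y, U y -> differentiable ('D_u f) y) ->
  exists a b, [/\ 0 <= a <= h, 0 <= b <= h &
    f (x + h *: u + h *: v) - f (x + h *: u) - (f (x + h *: v) - f x) =
    'D_v ('D_u f) (x + a *: u + b *: v) * h * h].
Proof.
move=> h0 hU df ddf.
have ih : 0 <= h <= h by apply/andP.
pose g y := f (y + h *: v) - f y.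
have fs y : U (y + h *: v) -> differentiable (fun y => f (y + h *: v)) y /\
    'D_u (fun y => f (y + h *: v)) y = 'D_u f (y + h *: v).
  move=> Uy; have ds : is_diff y (fun y => y + h *: v) id.
    by apply: is_diff_eq; rewrite addr0.
  case: ds => ds dsE.
  have dc : differentiable (f \o (fun y => y + h *: v)) y.
    by apply: differentiable_comp; [exact: ds|exact: df].
  split=> //; rewrite (deriveE _ dc) diff_comp //=; last exact: df.
  by rewrite dsE deriveE //; apply: df.
have Uv a : 0 <= a <= h -> U (x + a *: u + h *: v) by move=> ha; apply: hU.
have U0 a : 0 <= a <= h -> U (x + a *: u).
  move=> ha; rewrite -[x + _]addr0 -(scale0r v); apply: hU => //.
  by apply/andP.
have [|a ha] := @MVT_line _ _ g x u h h0.
  move=> a ha; apply: differentiableB; first by apply: (fs _ _).1; apply: Uv.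
  by apply/df/U0.
rewrite /g => E1; have [d1 d1E] := fs _ (Uv a ha).
move: E1; rewrite [X in _ = X * _ -> _]deriveB;
  [|exact: diff_derivable|exact/diff_derivable/df/U0].
rewrite d1E => E1.
have [|b hb E2] := @MVT_line _ _ ('D_u f) (x + a *: u) v h h0.
  by move=> b hb; apply/ddf/hU.
by exists a, b; split=> //; rewrite -E2 -E1.
Qed.

(** The second difference is symmetric in [u] and [v], so values of the two mixed derivatives at two
    points near [x] coincide. If they differed at [x], continuity would keep each within half of the
    gap, a contradiction. *)
Lemma derive_commute f x u v U : open U -> U x ->
  (forall y, U y -> differentiable f y) ->
  (forall y, U y -> differentiable ('D_u f) y) ->
  (forall y, U y -> differentiable ('D_v f) y) ->
  {for x, continuous ('D_v ('D_u f))} -> {for x, continuous ('D_u ('D_v f))} ->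
  'D_v ('D_u f) x = 'D_u ('D_v f) x.
Proof.
move=> oU Ux df du dv cuv cvu; apply/eqP/negPn/negP => ne.
pose e := `|'D_v ('D_u f) x - 'D_u ('D_v f) x| / 2.
have e0 : 0 < e by rewrite divr_gt0 // normr_gt0 subr_eq0.
have : \forall y \near x, [/\ U y, `|'D_v ('D_u f) x - 'D_v ('D_u f) y| < e &
    `|'D_u ('D_v f) x - 'D_u ('D_v f) y| < e].
  have nU := open_nbhs_nbhs (conj oU Ux).
  have A : \forall y \near x, `|'D_v ('D_u f) x - 'D_v ('D_u f) y| < e.
    by move/cvgrPdist_lt : cuv; apply.
  have B : \forall y \near x, `|'D_u ('D_v f) x - 'D_u ('D_v f) y| < e.
    by move/cvgrPdist_lt : cvu; apply.
  by apply: filterS3 nU A B => y; split.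
move=> /nbhs_ballP[r /= r0 xr].
(* This makes [h * (|u| + |v|)] less than [r], so the parallelogram of side parameter [h] stays in
   the ball; the [1] keeps the denominator positive. *)
pose h := r / 2 / (`|u| + `|v| + 1).
have s0 : 0 < `|u| + `|v| + 1 by rewrite ltr_wpDl // addr_ge0.
have h0 : 0 < h by rewrite !divr_gt0.
have hW y z a b : `|y| + `|z| = `|u| + `|v| ->
    0 <= a <= h -> 0 <= b <= h -> ball x r (x + a *: y + b *: z).
  move=> yz /andP[a0 ah] /andP[b0 bh]; rewrite -ball_normE /= -addrA opprD addNKr normrN.
  rewrite (le_lt_trans (ler_normD _ _)) // !normrZ !ger0_norm //.
  have: a * `|y| + b * `|z| <= h * (`|u| + `|v|).
    by rewrite -yz mulrDr lerD // ler_wpM2r.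
  move=> /le_lt_trans; apply.
  have: h * (`|u| + `|v| + 1) = r / 2 by rewrite /h divfK // gt_eqF.
  by rewrite mulrDr mulr1 => /half_lt; apply.
have [|||a [b [ha hb E]]] := @second_difference f x u v U h (ltW h0).
- by move=> a b ha hb; have [] := xr _ (hW u v a b erefl ha hb).
- exact: df.
- exact: du.
have [|||a' [b' [ha' hb' E']]] := @second_difference f x v u U h (ltW h0).
- by move=> a' b' ha' hb'; have [] := xr _ (hW v u a' b' (addrC _ _) ha' hb').
- exact: df.
- exact: dv.
have [_ A _] := xr _ (hW u v a b erefl ha hb).
have [_ _ B] := xr _ (hW v u a' b' (addrC _ _) ha' hb').
have EE : 'D_v ('D_u f) (x + a *: u + b *: v) = 'D_u ('D_v f) (x + a' *: v + b' *: u).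
  apply: (mulIf (lt0r_neq0 h0)); apply: (mulIf (lt0r_neq0 h0)).
  apply: (eq_trans (esym E)); apply: (eq_trans _ E').
  rewrite (addrAC x (h *: v)).
  move: (f (x + h *: u + h *: v)) (f (x + h *: u)) (f (x + h *: v)) (f x).
  by move=> p q s t; rewrite !opprB addrACA [RHS]addrACA (addrC (- q)).
have : `|'D_v ('D_u f) x - 'D_u ('D_v f) x| < e + e.
  exact: dist_lt_common A B EE.
by rewrite -splitr ltxx.
Qed.

End SymmetryOfDerivatives.

Lemma pd_commute (R : realType) (f : 'rV[R]_2 -> R) (U : set 'rV[R]_2)
    (i j : 'I_2) (x : 'rV[R]_2) : open U -> smooth 2 U f -> U x ->
  pd i (pd j f) x = pd j (pd i f) x.
Proof.
move=> oU [df sf] Ux; have [di si] := sf i; have [dj sj] := sf j.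
by apply: (derive_commute oU) => //; [apply: (sj i)|apply: (si j)].
Qed.

(** * Gluing along the line u = 0 *)

Section Gluing.
Context {R : realType}.
Notation V2 := 'rV[R]_2.
Implicit Types (f g : V2 -> R) (U : set V2) (x : V2) (k : nat) (i j : 'I_2).

(** Unlike in [glue], the second branch is evaluated at [x] itself: the mirror is absorbed into [g],
    so that partials of both branches compare without signs. *)
Definition sglue f g : V2 -> R := fun x => if 0 <= x 0 0 then f x else g x.

Lemma near_coord_gt0 x : 0 < x 0 0 -> \forall y \near x, 0 < (y : V2) 0 0.
Proof.
move=> x0; have : (fun y : V2 => y 0 0) y @[y --> x] --> x 0 0.
  exact: coord_continuous.
by move/cvgr_gt => /(_ _ x0).
Qed.

Lemma near_coord_lt0 x : x 0 0 < 0 -> \forall y \near x, (y : V2) 0 0 < 0.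
Proof.
move=> x0; have : (fun y : V2 => y 0 0) y @[y --> x] --> x 0 0.
  exact: coord_continuous.
by move/cvgr_lt => /(_ _ x0).
Qed.

Lemma sglue_near_pos f g x : 0 < x 0 0 -> {near x, f =1 sglue f g}.
Proof.
by move/near_coord_gt0; apply: filterS => y y0; rewrite /sglue ltW.
Qed.

Lemma sglue_near_neg f g x : x 0 0 < 0 -> {near x, g =1 sglue f g}.
Proof.
by move/near_coord_lt0; apply: filterS => y y0; rewrite /sglue leNgt y0.
Qed.

Lemma diff_pd f x (v : V2) : differentiable f x ->
  'd f x v = v 0 0 * pd 0 f x + v 0 1 * pd 1 f x.
Proof.
by move=> df; rewrite -{1}(pt2_eta v) linear_pt2 /pd !deriveE.
Qed.

(** Both branches have the same first-order expansion at [x], so the remainder estimate holds on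
    whichever side [h + x] falls. *)
Lemma sglue_line f g x : x 0 0 = 0 -> f x = g x ->
  differentiable f x -> differentiable g x ->
  (forall i, pd i f x = pd i g x) ->
  differentiable (sglue f g) x /\ forall i, pd i (sglue f g) x = pd i f x.
Proof.
move=> x0 fg df dg pfg.
have dd v : 'd g x v = 'd f x v.
  by rewrite (diff_pd v dg) (diff_pd v df) (pfg 0) (pfg 1).
have [||d dE] := @differentiable_local _ _ _ (sglue f g) ('d f x) x.
- exact: diff_continuous.
- move=> e e0; have := differentiable_remainder dg e0.
  apply: filterS2 (differentiable_remainder df e0) => h fh gh.
  have E : sglue f g x = f x by rewrite /sglue x0 lexx.
  have [->|->] : sglue f g (h + x) = f (h + x) \/ sglue f g (h + x) = g (h + x).
  - by rewrite /sglue; case: ifP; [left|right].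
  - by rewrite E; exact: fh.
  - by rewrite E fg -dd; exact: gh.
split=> // i; rewrite /pd (deriveE _ d) (deriveE _ df).
exact: (congr1 (fun u : V2 -> R => u _) dE).
Qed.

(** Agreement of the [k]-jets along the line, with every order of differentiation listed
    separately. *)
Fixpoint compat k U f g : Prop :=
  (forall x, U x -> x 0 0 = 0 -> f x = g x) /\
  match k with
  | 0%N => True
  | k'.+1 => forall i, compat k' U (pd i f) (pd i g)
  end.

Lemma compat_eq k U f g : compat k U f g ->
  forall x, U x -> x 0 0 = 0 -> f x = g x.
Proof. by case: k => [|k] []. Qed.

(** The partials of the glued function are the glued partials, which lets the induction on [k]
    proceed. *)
Lemma smooth_sglue k U f g : open U -> smooth k U f -> smooth k U g ->
  compat k U f g -> smooth k U (sglue f g).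
Proof.
move=> oU; elim: k f g => [|k IH] f g.
  move=> cf cg [fg _] x Ux.
  have [x0|x0|x0] := ltgtP 0 (x 0 0).
  - by apply: cvg_trans (near_eq_cvg (sglue_near_pos f g x0)) _;
      rewrite /sglue ltW //; apply: cf.
  - by apply: cvg_trans (near_eq_cvg (sglue_near_neg f g x0)) _;
      rewrite /sglue leNgt x0; apply: cg.
  have E : sglue f g x = f x by rewrite /sglue -x0 lexx.
  have : sglue f g y @[y --> x] --> f x; last by rewrite -E.
  apply/(@cvgrPdist_lt _ _ _ (nbhs x) (nbhs_filter x)) => e e0.
  have fe : \forall y \near x, `|f x - f y| < e.
    by move/cvgrPdist_lt : (cf x Ux); apply.
  have ge : \forall y \near x, `|g x - g y| < e.
    by move/cvgrPdist_lt : (cg x Ux); apply.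
  apply: filterS2 fe ge => y fy gy; rewrite /sglue; case: ifP => // _.
  by rewrite (fg x).
move=> [df sf] [dg sg] [fg pfg].
have key x : U x -> differentiable (sglue f g) x /\
    forall i, sglue (pd i f) (pd i g) x = pd i (sglue f g) x.
  move=> Ux; have [x0|x0|x0] := ltgtP 0 (x 0 0).
  - split; first exact: near_eq_differentiable (sglue_near_pos f g x0) (df x Ux).
    by move=> i; rewrite /sglue (ltW x0); apply/pd_near/sglue_near_pos.
  - split; first exact: near_eq_differentiable (sglue_near_neg f g x0) (dg x Ux).
    by move=> i; rewrite {1}/sglue leNgt x0; apply/pd_near/sglue_near_neg.
  have [] := @sglue_line f g x (esym x0) (fg x Ux (esym x0)) (df x Ux) (dg x Ux).
    by move=> i; apply: compat_eq (pfg i) _ _ _.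
  by move=> d E; split=> // i; rewrite {1}/sglue -x0 lexx E.
split=> [x /key[]//|i].
apply: (smooth_eq oU) (IH _ _ (sf i) (sg i) (pfg i)) => x /set_mem /key[_ ->//].
Qed.

(** Direction [1] is tangent to the line. Tangential derivatives of identities on the line thus come
    for free, leaving only conditions on normal derivatives. *)
Lemma pd1_line U f : open U -> (forall x, U x -> differentiable f x) ->
  (forall x, U x -> x 0 0 = 0 -> f x = 0) ->
  forall x, U x -> x 0 0 = 0 -> pd 1 f x = 0.
Proof.
move=> oU df f0 x Ux x0.
have /is_derive_line H : differentiable f (x + 0 *: delta_mx 0 1).
  by rewrite scale0r addr0; apply: df.
have := @derive_val _ _ _ _ _ _ _ H; rewrite scale0r addr0 => E.
rewrite /pd -E.
rewrite -[RHS](derive_cst (0 : R) (0 : R) 1); apply: near_eq_derive.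
have nU : nbhs (x + 0 *: (delta_mx 0 1 : V2)) U.
  by rewrite scale0r addr0; apply: open_nbhs_nbhs.
have cl : {for 0, continuous (fun s : R => x + s *: (delta_mx 0 1 : V2))}.
  by apply: continuousD; [exact: cst_continuous|exact: scalel_continuous].
have H2 : \forall s \near (0 : R), U (x + s *: delta_mx 0 1) by exact: cl nU.
apply: filterS H2 => s Us.
by apply: f0 => //; rewrite !mxE x0 mulr0 addr0.
Qed.

(** The directional derivative is bounded near [x], and the mean value theorem turns the bound into
    a Lipschitz constant. This feeds the coefficients [B] and [M] on the boundary line to the shear
    construction. *)
Lemma C1_lipschitz_line U f x (v : V2) : open U -> U x ->
  (forall y, U y -> differentiable f y) -> {for x, continuous ('D_v f)} ->
  exists e L : R, [/\ 0 < e, 0 < L & forall a b, `|a| <= e -> `|b| <= e ->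
    U (x + a *: v) /\ `|f (x + a *: v) - f (x + b *: v)| <= L * `|a - b|].
Proof.
move=> oU Ux df cf.
have : \forall y \near x, U y /\ `|'D_v f y| <= `|'D_v f x| + 1.
  move/cvgrPdist_le : cf => /(_ 1 ltr01) cf; near=> y; split.
    by near: y; exact: open_nbhs_nbhs.
  have : `|'D_v f x - 'D_v f y| <= 1 by near: y.
  rewrite distrC => H; rewrite -[X in `|X|](subrK ('D_v f x)) addrC.
  by rewrite (le_trans (ler_normD _ _)) // lerD2l.
move=> /nbhs_ballP[r /= r0 xr].
have s0 : 0 < `|v| + 1 by rewrite ltr_wpDl.
pose e := r / 2 / (`|v| + 1).
have e0 : 0 < e by rewrite !divr_gt0.
have hB a : `|a| <= e -> ball x r (x + a *: v).
  move=> ae; rewrite -ball_normE /= opprD addNKr normrN normrZ.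
  have: `|a| * `|v| <= e * `|v| by rewrite ler_wpM2r.
  move=> /le_lt_trans; apply.
  have: e * (`|v| + 1) = r / 2 by rewrite /e divfK // gt_eqF.
  by rewrite mulrDr mulr1 => /half_lt; apply.
exists e, (`|'D_v f x| + 1); split; [by []|exact: ltr_wpDl|].
move=> a b ae be; split; first by have [] := xr _ (hB a ae).
wlog ab : a b ae be / b <= a.
  move=> H; have [/H->//|/ltW ab] := leP b a.
  by rewrite distrC (distrC a); apply: H.
have xE t : x + b *: v + t *: v = x + (b + t) *: v by rewrite scalerDl addrA.
have bt t : 0 <= t <= a - b -> `|b + t| <= e.
  move: ae be; rewrite !ler_norml => /andP[? ?] /andP[? ?] /andP[? ?].
  by apply/andP; split; lra.
have [||t tab] := @MVT_line _ _ f (x + b *: v) v (a - b).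
- by rewrite subr_ge0.
- by move=> t /bt te; rewrite xE; apply: df; have [] := xr _ (hB _ te).
rewrite !xE (addrC b (a - b)) subrK => ->; rewrite normrM ler_wpM2r //.
by have [] := xr _ (hB _ (bt _ tab)).
Unshelve. all: by end_near. Qed.

End Gluing.

(** * Piecewise shears are homeomorphisms *)

Section Homeomorphism.
Context {R : realType}.
Notation V2 := 'rV[R]_2.

Lemma lipschitz_continuous (f : R -> R) (L : R) : 0 < L ->
  (forall a b, `|f a - f b| <= L * `|a - b|) -> continuous f.
Proof.
move=> L0 Lf a; apply/(@cvgrPdist_lt _ _ _ (nbhs a) (nbhs_filter a)) => e e0.
apply/nbhs_ballP; exists (e / L) => /= [|b]; first exact: divr_gt0.
rewrite -ball_normE /= ltr_pdivlMr // mulrC => ab.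
exact: le_lt_trans (Lf a b) ab.
Qed.

Lemma solve_shift (k : R -> R) (y : R) :
  (forall a b, `|k a - k b| <= `|a - b| / 2) -> exists a, a + k a = y.
Proof.
(* Over a distance [2 * d] the value of [k] changes by at most [d], so [k] is at most [2 * d] in
   absolute value at [y - 2 * d] and [y + 2 * d]; the values of [a + k a] there enclose [y]. *)
move=> hk; pose d := `|k y|; have d0 : 0 <= d by apply: normr_ge0.
have ck : continuous (fun a => a + k a).
  apply: (@lipschitz_continuous _ 2) => // a b.
  have -> : a + k a - (b + k b) = (a - b) + (k a - k b) by ring.
  rewrite (le_trans (ler_normD _ _)) //; have := hk a b.
  have := normr_ge0 (a - b); lra.
have k1 := hk (y - 2 * d) y; have k2 := hk (y + 2 * d) y.
have e1 : `|y - 2 * d - y| = 2 * d.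
  by rewrite addrAC subrr sub0r normrN ger0_norm // mulr_ge0.
have e2 : `|y + 2 * d - y| = 2 * d by rewrite addrAC subrr add0r ger0_norm // mulr_ge0.
have hd : - d <= k y <= d by rewrite -ler_norml.
move: k1 k2; rewrite e1 e2 !ler_norml => /andP[k1 k1'] /andP[k2 k2'].
have [|||a _ ay] := @IVT R (fun a => a + k a) (y - 2 * d) (y + 2 * d) y.
- by lra.
- exact: continuous_subspaceT.
- apply/andP; split; [rewrite ge_min|rewrite le_max]; apply/orP; [left|right];
  by move: hd => /andP[? ?]; lra.
by exists a.
Qed.

(** The reverse triangle inequality; it yields both injectivity of [a + k a] and a Lipschitz bound
    for its inverse. *)
Lemma shift_expands (k : R -> R) (a b : R) :
  (forall a b, `|k a - k b| <= `|a - b| / 2) ->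
  `|a - b| <= 2 * `|(a + k a) - (b + k b)|.
Proof.
move=> hk; have := hk a b.
have : `|a - b| <= `|(a + k a) - (b + k b)| + `|k a - k b|.
  rewrite (distrC (k a)).
  have -> : a - b = ((a + k a) - (b + k b)) + (k b - k a) by ring.
  exact: ler_normD.
lra.
Qed.

(** The fibre over [t] carries the map [x + k t x], invertible by [solve_shift] and [shift_expands];
    what remains is the joint continuity of the inverse in both variables. *)
Lemma shear_inverse (k : R -> R -> R) :
  continuous (fun z : V2 => k (z 0 0) (z 0 1)) ->
  (forall t a b, `|k t a - k t b| <= `|a - b| / 2) ->
  exists g : V2 -> R, [/\ continuous g,
    forall t y, g (pt2 t y) + k t (g (pt2 t y)) = y &
    forall t x, g (pt2 t (x + k t x)) = x].
Proof.
move=> ck hk.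
have /choice[g gE] : forall z : V2, exists a, a + k (z 0 0) a = z 0 1.
  by move=> z; apply/solve_shift/hk.
have g1 t y : g (pt2 t y) + k t (g (pt2 t y)) = y.
  by have := gE (pt2 t y); rewrite pt2_0 pt2_1.
exists g; split=> //; last first.
  move=> t x; apply/eqP; rewrite -subr_eq0 -normr_le0.
  by rewrite (le_trans (shift_expands _ _ (hk t))) // g1 subrr normr0 mulr0.
move=> z; apply/(@cvgrPdist_lt _ _ _ (nbhs z) (nbhs_filter z)) => e e0.
(* [F w] is the residual of [g z] as a candidate solution for [w]. It is continuous, vanishes at
   [z], and by [shift_expands] bounds the distance from [g z] to [g w] up to a factor 2. *)
pose F (w : V2) := g z + k (w 0 0) (g z) - w 0 1.
have cF : {for z, continuous F}.
  apply: continuousB; last exact: coord_continuous.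
  apply: continuousD; first exact: cst_continuous.
  have := @pt2_continuous _ _ (fun w : V2 => w 0 0) (fun=> g z) z.
  move=> /(_ (@coord_continuous R _ _ 0 0 z) (@cst_continuous _ _ (g z) z)) c.
  have E : (fun w : V2 => k (w 0 0) (g z)) =
      (fun z : V2 => k (z 0 0) (z 0 1)) \o (fun w : V2 => pt2 (w 0 0) (g z)).
    by apply/funext => w /=; rewrite pt2_0 pt2_1.
  by rewrite E; exact: (continuous_comp c (ck _)).
have Fz : F z = 0 by rewrite /F gE subrr.
have e20 : 0 < e / 2 by rewrite divr_gt0.
have nF : \forall w \near z, `|F z - F w| < e / 2.
  by move/(@cvgrPdist_lt _ _ _ (nbhs z) (nbhs_filter z)) : cF; apply.
apply: filterS nF => w; rewrite Fz sub0r normrN => Fw.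
rewrite (le_lt_trans (shift_expands _ _ (hk (w 0 0)))) // gE.
by rewrite -/(F w); lra.
Qed.

(** Truncation extends local data to the whole line without enlarging Lipschitz constants, so that
    the shears become homeomorphisms of the whole plane. *)
Definition clip (d a : R) : R := Num.max (- d) (Num.min d a).

Lemma clipP d a : 0 < d ->
  [\/ a <= - d /\ clip d a = - d, - d <= a <= d /\ clip d a = a |
      d <= a /\ clip d a = d].
Proof.
move=> d0; rewrite /clip; have [da|ad] := leP d a.
  by apply: Or33; rewrite max_r //; lra.
have [da|da] := leP (- d) a; last by apply: Or31; rewrite ltW.
by apply: Or32; rewrite ltW.
Qed.

Lemma clip_le d a : 0 < d -> `|clip d a| <= d.
Proof.
move=> d0; rewrite ler_norml.
by case: (clipP a d0) => [[? ->]|[/andP[? ?] ->]|[? ->]]; apply/andP; split; lra.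
Qed.

Lemma clip_id d a : 0 < d -> `|a| <= d -> clip d a = a.
Proof.
move=> d0; rewrite ler_norml => /andP[? ?].
by case: (clipP a d0) => [[? ->]|[/andP[? ?] ->]|[? ->]]; lra.
Qed.

Lemma clip_lipschitz d a b : 0 < d -> `|clip d a - clip d b| <= `|a - b|.
Proof.
move=> d0; wlog ab : a b / b <= a.
  move=> H; have [/H->//|/ltW ab] := leP b a.
  by rewrite distrC (distrC a); apply: H.
rewrite [leRHS]ger0_norm ?subr_ge0 // ler_norml.
case: (clipP a d0) => [[? ->]|[/andP[? ?] ->]|[? ->]];
case: (clipP b d0) => [[? ->]|[/andP[? ?] ->]|[? ->]];
by apply/andP; split; lra.
Qed.

Lemma clip_continuous d : 0 < d -> continuous (clip d).
Proof.
move=> d0; apply: (@lipschitz_continuous _ 1) => // a b.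
by rewrite mul1r clip_lipschitz.
Qed.

(** The product of [a] and [|a|] is the odd continuation of the square, which mirror symmetry forces
    in place of [s^2]. *)
Lemma signed_square_lipschitz (a b d : R) : `|a| <= d -> `|b| <= d ->
  `|a * `|a| - b * `|b| | <= 2 * d * `|a - b|.
Proof.
move=> ad bd.
have -> : a * `|a| - b * `|b| = a * (`|a| - `|b|) + (a - b) * `|b| by ring.
rewrite (le_trans (ler_normD _ _)) // !normrM (normr_id b).
have -> : 2 * d * `|a - b| = d * `|a - b| + `|a - b| * d by ring.
rewrite lerD //; last by rewrite ler_wpM2l.
by rewrite ler_pM // ler_dist_dist.
Qed.

(** Two shears are composed: [tau] moves the first coordinate at fixed [t], then [sig] moves the
    second at fixed [u]. After clipping, each perturbs the identity on its fibres by a contraction.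
    The bound on [m] is recorded because it gives [u] the sign of the first coordinate. *)
Lemma piecewise_shear_homeomorphism (b m : R -> R) (t0 e L : R) : 0 < e -> 0 < L ->
  (forall h h', `|h| <= e -> `|h'| <= e ->
    `|b (t0 + h) - b (t0 + h')| <= L * `|h - h'|) ->
  (forall h h', `|h| <= e -> `|h'| <= e ->
    `|m (t0 + h) - m (t0 + h')| <= L * `|h - h'|) ->
  exists rho rho' : V2 -> V2, [/\ continuous rho, continuous rho',
    cancel rho rho', cancel rho' rho &
    exists2 r : R, 0 < r & forall x : V2, `|x 0 0| <= r -> `|x 0 1 - t0| <= r ->
      let u := x 0 0 + m (x 0 1) * (x 0 0 * `|x 0 0|) in
      `|m (x 0 1)| * `|x 0 0| <= 1 / 2 /\ rho x = pt2 u (x 0 1 - b (x 0 1) * `|u|)].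
Proof.
move=> e0 L0 Lb Lm.
(* Freezing [b] and [m] beyond distance [e] from [t0] makes them globally Lipschitz. *)
pose bh t := b (t0 + clip e (t - t0)); pose mh t := m (t0 + clip e (t - t0)).
have lip (q : R -> R) : (forall h h', `|h| <= e -> `|h'| <= e ->
      `|q (t0 + h) - q (t0 + h')| <= L * `|h - h'|) ->
    forall t t',
      `|q (t0 + clip e (t - t0)) - q (t0 + clip e (t' - t0))| <= L * `|t - t'|.
  move=> Lq t t'; rewrite (le_trans (Lq _ _ (clip_le _ e0) (clip_le _ e0))) //.
  rewrite ler_pM2l // (le_trans (clip_lipschitz _ _ e0)) //.
  by rewrite opprB addrA subrK.
have Lbh : forall t t', `|bh t - bh t'| <= L * `|t - t'| by apply: lip.
have Lmh : forall t t', `|mh t - mh t'| <= L * `|t - t'| by apply: lip.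
have cbh := lipschitz_continuous L0 Lbh; have cmh := lipschitz_continuous L0 Lmh.
pose M := `|m t0| + L * e + 1.
have M0 : 0 < M by rewrite ltr_wpDl // addr_ge0 // ltW // mulr_gt0.
have hM t : `|mh t| <= M.
  have := Lm (clip e (t - t0)) 0 (clip_le _ e0); rewrite normr0 => /(_ (ltW e0)).
  rewrite addr0 subr0 -/(mh t) => H.
  have : L * `|clip e (t - t0)| <= L * e by rewrite ler_pM2l // clip_le.
  have : `|mh t| <= `|mh t - m t0| + `|m t0|.
    by rewrite -{1}(subrK (m t0) (mh t)) ler_normD.
  rewrite /M; lra.
(* The perturbations below have Lipschitz constants [2 * M * d] and [L * d']; both become the
   [1 / 2] that [shear_inverse] asks for. *)
pose d := (4 * M)^-1; pose d' := (2 * L)^-1.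
have d0 : 0 < d by rewrite invr_gt0 mulr_gt0.
have d'0 : 0 < d' by rewrite invr_gt0 mulr_gt0.
pose k1 t s := mh t * (clip d s * `|clip d s|).
pose k2 u t := - (bh t * `|clip d' u|).
have cc j : continuous (fun z : V2 => z 0 j) by exact: coord_continuous.
have Cc (q : R -> R) j : continuous q -> continuous (fun z : V2 => q (z 0 j)).
  by move=> cq z; exact: (continuous_comp (cc j z) (cq _)).
have cn (q : V2 -> R) : continuous q -> continuous (fun z => `|q z|).
  by move=> cq z; exact: (cvg_norm (cq z)).
have cM (p q : V2 -> R) : continuous p -> continuous q ->
    continuous (fun z => p z * q z).
  by move=> cp cq z; exact: (cvgM (cp z) (cq z)).
have cD (p q : V2 -> R) : continuous p -> continuous q ->
    continuous (fun z => p z + q z).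
  by move=> cp cq z; exact: (cvgD (cp z) (cq z)).
have cN (p : V2 -> R) : continuous p -> continuous (fun z => - p z).
  by move=> cp z; exact: (cvgN (cp z)).
have cp2 (p q : V2 -> R) : continuous p -> continuous q ->
    continuous (fun z => pt2 (p z) (q z)).
  by move=> cp cq z; exact: (pt2_continuous (cp z) (cq z)).
have cc1 := Cc _ 1 (clip_continuous d0).
have ck1 : continuous (fun z : V2 => k1 (z 0 0) (z 0 1)).
  apply: (cM); first exact: Cc.
  by apply: (cM) => //; apply: (cn).
have ck2 : continuous (fun z : V2 => k2 (z 0 0) (z 0 1)).
  by apply/cN/cM; [exact: Cc|apply/cn/Cc/clip_continuous].
have dM : M * d = 1 / 4 by rewrite /d; field; rewrite gt_eqF.
have dL : L * d' = 1 / 2 by rewrite /d'; field; rewrite gt_eqF.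
have h1 t s s' : `|k1 t s - k1 t s'| <= `|s - s'| / 2.
  rewrite /k1 -mulrBr normrM.
  have A := signed_square_lipschitz (clip_le s d0) (clip_le s' d0).
  apply: (@le_trans _ _ (M * (2 * d * `|s - s'|))).
    apply: ler_pM => //; apply: (le_trans A).
    by rewrite ler_pM2l ?mulr_gt0 // clip_lipschitz.
  have -> : M * (2 * d * `|s - s'|) = 2 * (M * d) * `|s - s'| by ring.
  by rewrite dM; lra.
have h2 u t t' : `|k2 u t - k2 u t'| <= `|t - t'| / 2.
  have -> : k2 u t - k2 u t' = (bh t' - bh t) * `|clip d' u| by rewrite /k2; ring.
  rewrite normrM normr_id distrC.
  apply: (@le_trans _ _ (L * `|t - t'| * d')); first by rewrite ler_pM // clip_le.
  have -> : L * `|t - t'| * d' = (L * d') * `|t - t'| by ring.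
  by rewrite dL; lra.
have [g1 [cg1 g1E g1K]] := shear_inverse ck1 h1.
have [g2 [cg2 g2E g2K]] := shear_inverse ck2 h2.
pose tau (x : V2) := pt2 (x 0 0 + k1 (x 0 1) (x 0 0)) (x 0 1).
pose tau' (x : V2) := pt2 (g1 (pt2 (x 0 1) (x 0 0))) (x 0 1).
pose sig (x : V2) := pt2 (x 0 0) (x 0 1 + k2 (x 0 0) (x 0 1)).
pose sig' (x : V2) := pt2 (x 0 0) (g2 x).
have tauK : cancel tau tau'.
  by move=> x; rewrite /tau /tau' !pt2_0 !pt2_1 g1K pt2_eta.
have tau'K : cancel tau' tau.
  by move=> x; rewrite /tau /tau' !pt2_0 !pt2_1 g1E pt2_eta.
have sigK : cancel sig sig'.
  by move=> x; rewrite /sig /sig' !pt2_0 g2K pt2_eta.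
have sig'K : cancel sig' sig.
  move=> x; rewrite -[x in sig' x]pt2_eta /sig /sig' !pt2_0 !pt2_1 g2E.
  exact: pt2_eta.
have csw : continuous (fun z : V2 => pt2 (z 0 1) (z 0 0)) by apply: (cp2).
have ctau : continuous tau.
  apply: (cp2) => //; apply: (cD) => //.
  have -> : (fun z : V2 => k1 (z 0 1) (z 0 0)) =
      (fun z : V2 => k1 (z 0 0) (z 0 1)) \o (fun z : V2 => pt2 (z 0 1) (z 0 0)).
    by apply/funext => z /=; rewrite pt2_0 pt2_1.
  by move=> z; exact: (continuous_comp (csw z) (ck1 _)).
have ctau' : continuous tau'.
  apply: (cp2) => //; move=> z.
  exact: (continuous_comp (csw z) (cg1 _)).
have csig : continuous sig by apply: (cp2) => //; apply: (cD).
have csig' : continuous sig' by apply: (cp2).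
exists (sig \o tau), (tau' \o sig'); split.
- by move=> z; exact: (continuous_comp (ctau z) (csig _)).
- by move=> z; exact: (continuous_comp (csig' z) (ctau' _)).
- exact: can_comp sigK tauK.
- exact: can_comp tau'K sig'K.
(* Within [e] and [d] the clips of [t] and [s] are inactive. Halving [d'] leaves room for [|u|],
   which is at most [5 / 4] times [|s|], so the third clip is inactive too. *)
exists (Num.min e (Num.min d (d' / 2))).
  by rewrite !lt_min e0 d0 divr_gt0.
move=> x; rewrite !le_min => /and3P[_ xd xd'] /andP[xe _] u.
have mE : mh (x 0 1) = m (x 0 1) by rewrite /mh clip_id // addrC subrK.
have bE : bh (x 0 1) = b (x 0 1) by rewrite /bh clip_id // addrC subrK.
have mx : `|m (x 0 1)| * `|x 0 0| <= 1 / 4 by rewrite -dM -mE ler_pM.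
split; first by lra.
have ud' : `|u| <= d'.
  rewrite /u (le_trans (ler_normD _ _)) // !normrM normr_id mulrA.
  have : `|m (x 0 1)| * `|x 0 0| * `|x 0 0| <= 1 / 4 * `|x 0 0| by rewrite ler_wpM2r.
  lra.
rewrite /= /sig /tau !pt2_0 !pt2_1 /k1 mE clip_id // -/u.
by rewrite /k2 bE clip_id.
Qed.

End Homeomorphism.

(** * The reparametrization near the common boundary *)

Section Reparametrization.
Context {R : realType}.
Notation V2 := 'rV[R]_2.
Implicit Types (f g h : V2 -> R) (U : set V2) (x : V2) (k : nat) (i j : 'I_2).

Lemma I2P (i : 'I_2) : i = 0 \/ i = 1.
Proof. by case: i => [[|[|//]] ?]; [left|right]; apply: val_inj. Qed.

Lemma pd_subZ i (c : R) f h x : differentiable f x -> differentiable h x ->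
  pd i (fun y => f y - c * h y) x = pd i f x - c * pd i h x.
Proof.
move=> df dh; have dc : differentiable (fun y => c * h y) x.
  by apply: differentiableM => //; apply: differentiable_cst.
rewrite /pd (deriveB (derivable_pd (i:=i) df) (derivable_pd (i:=i) dc)).
by rewrite -!/(pd i _ x) pdZ.
Qed.

Lemma mirror_line x : x 0 0 = 0 -> mirror x = x.
Proof. by move=> x0; rewrite /mirror x0 oppr0 -{2}(pt2_eta x) x0. Qed.

Definition msign i : R := if i == 0 then -1 else 1.

Lemma differentiable_mirror f x : differentiable f (mirror x) ->
  differentiable (fun y => f (mirror y)) x.
Proof.
move=> df; apply: differentiable_comp2 => //; last exact: differentiable_coord.
by apply: differentiableN; exact: differentiable_coord.
Qed.

Lemma pd_mirror i f x : differentiable f (mirror x) ->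
  pd i (fun y => f (mirror y)) x = msign i * pd i f (mirror x).
Proof.
move=> df; rewrite /mirror pd_comp //; last exact: differentiable_coord.
  rewrite pd_coord (_ : pd i (fun y => - y 0 0) x = - (i == 0)%:R).
    by case: (I2P i) => ->;
      rewrite /msign /= ?mulN1r ?mul0r ?oppr0 ?mul1r ?mul0r ?addr0 ?add0r.
  have dc := @differentiable_coord R _ _ x 0 0.
  by rewrite -(pd_coord i 0 x) /pd (deriveN (derivable_pd (i:=i) dc)).
by apply: differentiableN; exact: differentiable_coord.
Qed.

Lemma smooth_mirror k U f : open U -> (forall x, U x -> U (mirror x)) ->
  smooth k U f -> smooth k U (fun x => f (mirror x)).
Proof.
move=> oU mU sf; apply: (smooth_comp oU mU sf); last exact: smooth_coord.
by apply: smoothN => //; exact: smooth_coord.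
Qed.

Lemma smooth2_differentiable U f x i : smooth 2 U f -> U x ->
  differentiable f x /\ differentiable (pd i f) x.
Proof. by case=> df /(_ i)[di _] Ux; split; [apply: df|apply: di]. Qed.

(* [f] is a component of the surface and [h] its scalar product with the normal
   of the mirror plane, so that the second branch is the reflected surface. *)
Lemma smooth_sglue_reflection U f h (c : R) : open U ->
  (forall x, U x -> U (mirror x)) -> smooth 2 U f -> smooth 2 U h ->
  (forall x, U x -> x 0 0 = 0 ->
     [/\ h x = 0, pd 0 f x = c * pd 0 h x & pd 0 (pd 0 h) x = 0]) ->
  let F := sglue f (fun x => f (mirror x) - (2 * c) * h (mirror x)) in
  smooth 2 U F /\ forall x i, U x -> x 0 0 = 0 -> pd i F x = pd i f x.
Proof.
move=> oU mU sf sh H F; pose g0 x := f x - (2 * c) * h x.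
have sg0 : smooth 2 U g0 by exact: (smoothB oU sf (smoothZ _ oU sh)).
have sg : smooth 2 U (fun x => g0 (mirror x)) := smooth_mirror oU mU sg0.
have d1 u x i : smooth 2 U u -> U x -> differentiable u x.
  by move=> su /(smooth2_differentiable i su)[].
have d2 u x i : smooth 2 U u -> U x -> differentiable (pd i u) x.
  by move=> su /(smooth2_differentiable i su)[].
have df x Ux := d1 f x 0 sf Ux; have dh x Ux := d1 h x 0 sh Ux.
have dg0 x Ux := d1 g0 x 0 sg0 Ux; have dg x Ux := d1 _ x 0 sg Ux.
have ddf i x Ux := d2 f x i sf Ux; have ddh i x Ux := d2 h x i sh Ux.
have ddg i x Ux := d2 g0 x i sg0 Ux.
have h1 x : U x -> x 0 0 = 0 -> pd 1 h x = 0.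
  by apply: pd1_line => // y Uy y0; have [] := H y Uy y0.
have h11 x : U x -> x 0 0 = 0 -> pd 1 (pd 1 h) x = 0.
  by apply: pd1_line => //; apply: ddh.
(* The relation between [pd 0 f] and [pd 0 h] holds along the line with a constant [c], so it can be
   differentiated along it. *)
have f10 x : U x -> x 0 0 = 0 -> pd 1 (pd 0 f) x = c * pd 1 (pd 0 h) x.
  move=> Ux x0; apply/eqP; rewrite -subr_eq0 -pd_subZ; [|exact: ddf|exact: ddh].
  apply/eqP; apply: (@pd1_line _ U) => // y Uy.
    apply: differentiableB; first exact: ddf.
    by apply: differentiableM; [exact: differentiable_cst|exact: ddh].
  by move=> y0; have [_ -> _] := H y Uy y0; rewrite subrr.
have f01 x : U x -> x 0 0 = 0 -> pd 0 (pd 1 f) x = c * pd 0 (pd 1 h) x.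
  move=> Ux x0; rewrite (pd_commute _ _ oU sf Ux) (pd_commute _ _ oU sh Ux).
  exact: f10.
have pg0 i x : U x -> pd i g0 x = pd i f x - (2 * c) * pd i h x.
  by move=> Ux; rewrite pd_subZ; [|exact: df|exact: dh].
have pg i x : U x -> pd i (fun x => g0 (mirror x)) x = msign i * pd i g0 (mirror x).
  by move=> Ux; rewrite pd_mirror //; apply/dg0/mU.
have ppg0 i j x : U x ->
    pd j (pd i g0) x = pd j (pd i f) x - (2 * c) * pd j (pd i h) x.
  move=> Ux; rewrite -pd_subZ; [|exact: ddf|exact: ddh].
  by apply: (pd_eq_on _ oU) (mem_set Ux) => y /set_mem; apply: pg0.
have ppg i j x : U x -> pd j (pd i (fun x => g0 (mirror x))) x =
    msign i * (msign j * pd j (pd i g0) (mirror x)).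
  move=> Ux; have dm : differentiable (fun y => pd i g0 (mirror y)) x.
    by apply/differentiable_mirror/ddg/mU.
  rewrite -pd_mirror -?pdZ //; last exact/ddg/mU.
  by apply: (pd_eq_on _ oU) (mem_set Ux) => y /set_mem; apply: pg.
have comp1 i x : U x -> x 0 0 = 0 -> pd i f x = pd i (fun x => g0 (mirror x)) x.
  move=> Ux x0; rewrite pg // mirror_line // pg0 //; have [_ A _] := H x Ux x0.
  by case: (I2P i) => ->; rewrite /msign /= ?h1 ?A //; ring.
have cfg : compat 2 U f (fun x => g0 (mirror x)).
  split=> [x Ux x0|i].
    by have [A _ _] := H x Ux x0; rewrite mirror_line // /g0 A mulr0 subr0.
  split=> [|j]; first exact: comp1.
  split; last by [].
  move=> x Ux x0; rewrite (ppg i j x Ux) (mirror_line x0) (ppg0 i j x Ux).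
  have [_ _ A] := H x Ux x0.
  (* For two normal or two tangential derivatives the mirror signs cancel and the branches differ by
     a multiple of a second derivative of [h] that vanishes. For mixed ones the mirror changes the
     sign, and so does the reflection, since the derivative of [f] is [c] times that of [h]. *)
  case: (I2P i) => ->; case: (I2P j) => ->; rewrite /msign /=.
  - by rewrite A; ring.
  - by rewrite (f10 x Ux x0); ring.
  - by rewrite (f01 x Ux x0); ring.
  - by rewrite (h11 x Ux x0); ring.
split; first exact: (smooth_sglue oU sf sg cfg).
move=> x i Ux x0; apply: (sglue_line x0 _ (df x Ux) (dg x Ux) _).2.
  exact: compat_eq cfg x Ux x0.
by move=> j; apply: comp1.
Qed.

Lemma pd0_coord0 x : pd 0 (fun y => y 0 0) x = 1.
Proof. by rewrite pd_coord eqxx. Qed.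

Lemma pd0_coord1 x : pd 0 (fun y => y 0 1) x = 0.
Proof. by rewrite pd_coord. Qed.

Lemma pd0_coord_sq x : pd 0 (fun y => y 0 0 * y 0 0) x = 2 * x 0 0.
Proof.
by rewrite pdM ?pd0_coord0; [ring|exact: differentiable_coord..].
Qed.

Lemma smooth_reparam k U (M B : V2 -> R) : open U -> smooth k U M -> smooth k U B ->
  let r0 x := x 0 0 + M x * (x 0 0 * x 0 0) in
  smooth k U r0 /\ smooth k U (fun x => x 0 1 - B x * r0 x).
Proof.
move=> oU sM sB r0; have sc j := @smooth_coord _ k U j.
have s0 : smooth k U r0.
  exact: (smoothD oU (sc 0) (smoothM oU sM (smoothM oU (sc 0) (sc 0)))).
split; [exact: s0|exact: (smoothB oU (sc 1) (smoothM oU sB s0))].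
Qed.

(** As [M] and [B] do not vary with the first coordinate, [pd 0 F] is [1 + 2 * M x * x 0 0] times
    [pd 0 f - B * pd 1 f] at the moved point. Differentiating this product at [x 0 0 = 0] gives the
    second-order formula, in which [M] enters linearly and can be solved for. *)
Lemma pd_reparam U (M B f : V2 -> R) : open U ->
  smooth 2 U M -> smooth 2 U B ->
  (forall x, U x -> pd 0 M x = 0) -> (forall x, U x -> pd 0 B x = 0) ->
  smooth 2 setT f ->
  let r0 x := x 0 0 + M x * (x 0 0 * x 0 0) in
  let r1 x := x 0 1 - B x * r0 x in
  let F x := f (pt2 (r0 x) (r1 x)) in
  smooth 2 U F /\ forall x, U x -> x 0 0 = 0 ->
  [/\ F x = f x, pd 1 F x = pd 1 f x,
      pd 0 F x = pd 0 f x - B x * pd 1 f x &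
      pd 0 (pd 0 F) x = 2 * M x * (pd 0 f x - B x * pd 1 f x) +
        (pd 0 (pd 0 f) x - B x * pd 1 (pd 0 f) x) -
        B x * (pd 0 (pd 1 f) x - B x * pd 1 (pd 1 f) x)].
Proof.
move=> oU sM sB M0 B0 sf r0 r1 F.
have [s0 s1] := smooth_reparam oU sM sB; rewrite -/r0 -/r1 in s0 s1.
have sF : smooth 2 U F by exact: (smooth_comp oU (fun _ _ => I) sf s0 s1).
have [dM _] := sM; have [dB _] := sB; have [d0 _] := s0; have [d1 _] := s1.
have [dF _] := sF; have [df ddf'] := sf.
have dc j x : differentiable (fun y : V2 => y 0 j) x by exact: differentiable_coord.
have dcc x : differentiable (fun y : V2 => y 0 0 * y 0 0) x by apply: differentiableM.
have ddf i x : differentiable (pd i f) x by have [A _] := ddf' i; apply: A.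
have p0 x : U x -> pd 0 r0 x = 1 + 2 * M x * x 0 0.
  move=> Ux; have dMc : differentiable (fun y => M y * (y 0 0 * y 0 0)) x.
    by apply: differentiableM => //; apply: dM.
  rewrite /r0 pdD // pdM //; last exact: dM.
  by rewrite M0 // pd0_coord_sq pd0_coord0; ring.
have p1 x : U x -> pd 0 r1 x = - B x * (1 + 2 * M x * x 0 0).
  move=> Ux; have dBr : differentiable (fun y => B y * r0 y) x.
    by apply: differentiableM; [apply: dB|apply: d0].
  have E : r1 = fun y => y 0 1 - 1 * (B y * r0 y).
    by apply/funext => y; rewrite mul1r.
  rewrite E pd_subZ // pdM; [|exact: dB|exact: d0].
  by rewrite B0 // p0 // pd0_coord1; ring.
have comp0 g x : U x -> differentiable g (pt2 (r0 x) (r1 x)) ->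
    pd 0 (fun y => g (pt2 (r0 y) (r1 y))) x = (1 + 2 * M x * x 0 0) *
    (pd 0 g (pt2 (r0 x) (r1 x)) - B x * pd 1 g (pt2 (r0 x) (r1 x))).
  move=> Ux dg; rewrite pd_comp //; [|exact: d0|exact: d1].
  by rewrite p0 // p1 //; ring.
have line x : x 0 0 = 0 -> pt2 (r0 x) (r1 x) = x.
  move=> x0; rewrite /r1 /r0 x0 !mulr0 addr0 mulr0 subr0 -{2}(pt2_eta x) x0 //.
split=> // x Ux x0.
have E0 : pd 0 F x = pd 0 f x - B x * pd 1 f x.
  have := comp0 f x Ux (df _ I); rewrite (line x x0) x0 => E.
  by apply: (eq_trans E); rewrite mulr0 addr0 mul1r.
split=> //; first exact: (congr1 f (line x x0)).
  (* [F] and [f] agree on the line, hence so do their tangential derivatives; the factor [1] fits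
     the shape of [pd_subZ]. *)
  apply/eqP; rewrite -subr_eq0; apply/eqP.
  have := @pd1_line _ U (fun y => F y - 1 * f y) oU.
  move=> /(_ _ _ x Ux x0); rewrite pd_subZ ?mul1r; [|exact: dF|exact: df].
  apply=> [y Uy|y Uy y0]; last first.
    by rewrite (congr1 f (line y y0) : F y = f y) mul1r subrr.
  apply: differentiableB; first exact: dF.
  by apply: differentiableM; [exact: differentiable_cst|exact: df].
pose G i y := pd i f (pt2 (r0 y) (r1 y)).
have dG i : differentiable (G i) x.
  by apply: differentiable_comp2; [exact: d0|exact: d1|exact: ddf].
have EG i : pd 0 (G i) x = pd 0 (pd i f) x - B x * pd 1 (pd i f) x.
  have := comp0 (pd i f) x Ux (ddf i _); rewrite (line x x0) x0 => E.
  by apply: (eq_trans E); rewrite mulr0 addr0 mul1r.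
have dBG : differentiable (fun y => B y * G 1 y) x.
  by apply: differentiableM => //; apply: dB.
have dK : differentiable (fun y => G 0 y - 1 * (B y * G 1 y)) x.
  apply: differentiableB => //.
  by apply: differentiableM => //; exact: differentiable_cst.
have dMx : differentiable (fun y => M y * y 0 0) x.
  by apply: differentiableM => //; apply: dM.
have d2Mx : differentiable (fun y => 2 * (M y * y 0 0)) x.
  by apply: differentiableM => //; exact: differentiable_cst.
have d12 : differentiable (fun y => 1 + 2 * (M y * y 0 0)) x.
  by apply: differentiableD => //; exact: differentiable_cst.
have -> : pd 0 (pd 0 F) x =
    pd 0 (fun y => (1 + 2 * (M y * y 0 0)) * (G 0 y - 1 * (B y * G 1 y))) x.
  apply: (pd_eq_on _ oU) (mem_set Ux) => y /set_mem Uy.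
  apply: (eq_trans (comp0 f y Uy (df _ I))); rewrite /G.
  by rewrite mul1r mulrA.
have E1 : pd 0 (fun y => G 0 y - 1 * (B y * G 1 y)) x =
    (pd 0 (pd 0 f) x - B x * pd 1 (pd 0 f) x) -
    B x * (pd 0 (pd 1 f) x - B x * pd 1 (pd 1 f) x).
  rewrite (pd_subZ _ _ (dG 0) dBG) (pdM _ (dB x Ux) (dG 1)) (EG 0) (EG 1).
  by rewrite (B0 x Ux) mul0r add0r mul1r.
have E2 : pd 0 (fun y => 1 + 2 * (M y * y 0 0)) x = 2 * M x.
  rewrite (pdD _ (differentiable_cst _ _) d2Mx) pd_cst (pdZ _ _ dMx).
  rewrite (pdM _ (dM x Ux) (dc 0 x)) (M0 x Ux) pd0_coord0.
  by rewrite mul0r add0r mulr1 add0r.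
rewrite (pdM _ d12 dK) E1 E2 /G (line x x0) x0.
by rewrite mul1r !mulr0 addr0 mul1r addrA.
Qed.

End Reparametrization.

(** * Polynomial functions *)

Section PolynomialFunctions.
Context {R : realType}.
Notation V2 := 'rV[R]_2.
Implicit Types (f g : V2 -> R) (U : set V2) (k : nat) (i j : 'I_2).

(** An inductive predicate, so that smoothness, stability under [pd] and restriction to the boundary
    line as a univariate polynomial are each one induction. *)
Inductive polyfun : (V2 -> R) -> Prop :=
  | polyfun_cst (c : R) : polyfun (fun=> c)
  | polyfun_coord j : polyfun (fun x => x 0 j)
  | polyfunD f g : polyfun f -> polyfun g -> polyfun (fun x => f x + g x)
  | polyfunM f g : polyfun f -> polyfun g -> polyfun (fun x => f x * g x).

Lemma polyfun_smooth k U f : open U -> polyfun f -> smooth k U f.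
Proof.
move=> oU; elim=> {f} [c|j|f g _ sf _ sg|f g _ sf _ sg].
- exact: smooth_cst.
- exact: smooth_coord.
- exact: (smoothD oU sf sg).
- exact: (smoothM oU sf sg).
Qed.

Lemma polyfun_differentiable f (x : V2) : polyfun f -> differentiable f x.
Proof. by move=> /(polyfun_smooth 1 openT)[df _]; apply: df. Qed.

Lemma polyfun_continuous f : polyfun f -> continuous f.
Proof. by move=> pf x; apply/differentiable_continuous/polyfun_differentiable. Qed.

Lemma polyfun_pd i f : polyfun f -> polyfun (pd i f).
Proof.
elim=> {f} [c|j|f g pf IHf pg IHg|f g pf IHf pg IHg].
- rewrite (_ : pd i _ = fun=> 0); first exact: polyfun_cst.
  by apply/funext => x; exact: pd_cst.
- rewrite (_ : pd i _ = fun=> (i == j)%:R); first exact: polyfun_cst.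
  by apply/funext => x; exact: pd_coord.
- rewrite (_ : pd i _ = fun x => pd i f x + pd i g x); first exact: polyfunD.
  by apply/funext => x; apply: pdD; exact: polyfun_differentiable.
- rewrite (_ : pd i _ = fun x => pd i f x * g x + f x * pd i g x).
    by apply: polyfunD; exact: polyfunM.
  by apply/funext => x; apply: pdM; exact: polyfun_differentiable.
Qed.

Lemma polyfunZ (c : R) f : polyfun f -> polyfun (fun x => c * f x).
Proof. by apply: polyfunM; exact: polyfun_cst. Qed.

Lemma polyfunB f g : polyfun f -> polyfun g -> polyfun (fun x => f x - g x).
Proof.
move=> pf pg; rewrite (_ : (fun _ => _) = fun x => f x + (-1) * g x).
  by apply: polyfunD => //; exact: polyfunZ.
by apply/funext => x; rewrite mulN1r.
Qed.

Lemma polyfunX f m : polyfun f -> polyfun (fun x => f x ^+ m).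
Proof.
move=> pf; elim: m => [|m IH]; first exact: polyfun_cst.
rewrite (_ : (fun _ => _) = fun x => f x * f x ^+ m); first exact: polyfunM.
by apply/funext => x; rewrite exprS.
Qed.

Lemma polyfun_sum (I : Type) (r : seq I) (Q : pred I) (F : I -> V2 -> R) :
  (forall l, polyfun (F l)) -> polyfun (fun x => \sum_(l <- r | Q l) F l x).
Proof.
move=> pF; elim: r => [|l r IH].
  rewrite (_ : (fun _ => _) = fun=> 0); first exact: polyfun_cst.
  by apply/funext => x; rewrite big_nil.
case Ql: (Q l).
  rewrite (_ : (fun _ => _) = fun x => F l x + \sum_(l <- r | Q l) F l x).
    exact: polyfunD.
  by apply/funext => x; rewrite big_cons Ql.
rewrite (_ : (fun _ => _) = fun x => \sum_(l <- r | Q l) F l x) //.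
by apply/funext => x; rewrite big_cons Ql.
Qed.

Lemma polyfun_line f : polyfun f -> exists P : {poly R}, forall t, f (pt2 0 t) = P.[t].
Proof.
elim=> {f} [c|j|f g _ [P fP] _ [Q gQ]|f g _ [P fP] _ [Q gQ]].
- by exists c%:P => t; rewrite hornerC.
- case: (I2P j) => ->; first by exists 0 => t; rewrite pt2_0 horner0.
  by exists 'X => t; rewrite pt2_1 hornerX.
- by exists (P + Q) => t; rewrite hornerD fP gQ.
- by exists (P * Q) => t; rewrite hornerM fP gQ.
Qed.

Lemma polyfun_line_eq0 f : polyfun f ->
  (forall t, 0 <= t <= 1 -> f (pt2 0 t) = 0) -> forall t, f (pt2 0 t) = 0.
Proof.
move=> /polyfun_line[P fP] f0 t; rewrite fP.
have [->|P0] := eqVneq P 0; first by rewrite horner0.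
have sP : (0 < size P)%N by rewrite size_poly_gt0.
have sR : 0 < (size P)%:R :> R by rewrite ltr0n.
(* These are [size P] distinct points of [[0, 1)], hence one root more than the degree of [P]
   allows. *)
pose rs : seq R := [seq l%:R / (size P)%:R | l <- iota 0 (size P)].
suff /(max_poly_roots P0) : all (root P) rs.
  rewrite size_map size_iota ltnn map_inj_uniq ?iota_uniq; first by move/(_ isT).
  by move=> m l /(mulIf (invr_neq0 (lt0r_neq0 sR))) /eqP; rewrite eqr_nat => /eqP.
apply/allP => _ /mapP[l ls ->]; rewrite rootE -fP f0 //.
rewrite mem_iota add0n in ls; case/andP: ls => _ ls.
by rewrite divr_ge0 //= ler_pdivrMr // mul1r ler_nat ltnW.
Qed.

End PolynomialFunctions.

(** * Gram determinants and local parametrizations *)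

Section LocalParametrization.
Context {R : realType}.
Notation V2 := 'rV[R]_2.
Notation V3 := 'rV[R]_3.

Lemma dot3E (x y : V3) : dot x y = x 0 0 * y 0 0 + x 0 1 * y 0 1 + x 0 2 * y 0 2.
Proof.
rewrite /dot !big_ord_recl big_ord0 addr0 addrA.
by congr (_ * _ + _ * _ + _ * _); congr (_ _ _); apply: val_inj.
Qed.

Lemma pt3E (a b c : R) :
  (pt3 a b c 0 0 = a) * (pt3 a b c 0 1 = b) * (pt3 a b c 0 2 = c).
Proof. by rewrite !mxE. Qed.

Lemma I3P (j : 'I_3) : [\/ j = 0, j = 1 | j = 2].
Proof.
by case: j => [[|[|[|//]]] ?]; [apply: Or31|apply: Or32|apply: Or33]; apply: val_inj.
Qed.

(** By Lagrange's identity, the squared norm of [cross a b]. *)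
Definition gram (a b : V3) : R := dot a a * dot b b - dot a b ^+ 2.

Lemma dot_eq0 n (a : 'rV[R]_n) : dot a a = 0 -> a = 0.
Proof.
move=> a0; apply/rowP => j; rewrite mxE; apply/eqP; rewrite -sqrf_eq0 expr2.
by apply/eqP; apply: (psumr_eq0P _ a0) => // i _; rewrite -expr2 sqr_ge0.
Qed.

(** The vanishing triple product puts [a] in the plane of the orthogonal vectors [b] and [n], so [a]
    is the sum of its projections on them. *)
Lemma tangent_decomposition (a b n : V3) j :
  dot n n != 0 -> dot b n = 0 -> dot (cross a b) n = 0 -> dot b b != 0 ->
  a 0 j - dot a b / dot b b * b 0 j = n 0 j / dot n n * dot a n.
Proof.
move=> nn bn det bb.
apply: (mulfI nn); apply: (mulfI bb).
have -> : dot b b * (dot n n * (a 0 j - dot a b / dot b b * b 0 j)) =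
    dot b b * dot n n * a 0 j - dot n n * dot a b * b 0 j by field.
have -> : dot b b * (dot n n * (n 0 j / dot n n * dot a n)) =
    dot b b * dot a n * n 0 j by field.
pose g := dot b n; pose c := cross b n.
(* Expansion of [a] in [b], [n] and [cross b n], cleared of denominators: a polynomial identity
   valid for all [a], [b], [n]. *)
have H : (dot b b * dot n n - g ^+ 2) * a 0 j =
    (dot n n * dot a b - g * dot a n) * b 0 j +
    (dot b b * dot a n - g * dot a b) * n 0 j + dot (cross a b) n * c 0 j.
  rewrite /g /c /cross !dot3E !pt3E.
  by case: (I3P j) => ->; rewrite !pt3E; ring.
move: H; rewrite det /g bn !mul0r addr0 !subr0 expr0n subr0 => ->; ring.
Qed.

(** If [dot a n] were zero, the decomposition above would make [a] a multiple of [b]. The two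
    conclusions are the nonvanishing of the denominators of [B] and [M]. *)
Lemma transversal_of_gram (a b n : V3) :
  dot n n != 0 -> dot b n = 0 -> dot (cross a b) n = 0 -> gram a b != 0 ->
  dot b b != 0 /\ dot a n != 0.
Proof.
move=> nn bn det g0.
have bb : dot b b != 0.
  apply: contraNN g0 => /eqP /dot_eq0 ->; rewrite /gram !dot3E !mxE.
  by apply/eqP; ring.
split=> //; apply: contraNN g0 => /eqP an.
have Ea j : a 0 j = dot a b / dot b b * b 0 j.
  by apply/eqP; rewrite -subr_eq0 (tangent_decomposition _ nn bn det bb) an mulr0.
have -> : a = (dot a b / dot b b) *: b by apply/rowP => j; rewrite Ea !mxE.
by apply/eqP; rewrite /gram !dot3E !mxE; ring.
Qed.

(** For nonzero [b], the component of [a] orthogonal to [b] has squared norm [gram a b / dot b b];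
    if it vanishes, [a] lies on the line of [b]. *)
Lemma free_gram (a b : V3) : free [:: a; b] -> gram a b != 0.
Proof.
rewrite free_cons span_seq1 => /andP[ab fb]; apply: contraNN ab => /eqP g0.
have b0 : b != 0 by apply: contraTneq fb => ->; rewrite free_cons span_nil memv0 eqxx.
have bb : dot b b != 0 by apply: contraNneq b0 => /dot_eq0 ->.
apply/vlineP; exists (dot a b / dot b b); apply/eqP; rewrite -subr_eq0; apply/eqP.
apply: dot_eq0; apply: (mulfI bb); rewrite mulr0 -[RHS]g0 /gram.
set l := dot a b / dot b b.
have lb : l * dot b b = dot a b by rewrite /l divfK.
have -> : dot (a - l *: b) (a - l *: b) = dot a a - 2 * l * dot a b + l * (l * dot b b).
  by rewrite !dot3E !mxE; ring.
rewrite lb; have -> : dot b b * (dot a a - 2 * l * dot a b + l * dot a b) =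
  dot a a * dot b b - (l * dot b b) * dot a b by ring.
by rewrite lb expr2.
Qed.

Lemma dotC n (a b : 'rV[R]_n) : dot a b = dot b a.
Proof. by apply: eq_bigr => i _; rewrite mulrC. Qed.

Lemma det_gram (K : 'M[R]_2) (r : 'I_2 -> V3) :
  (forall i j, K i j = dot (r i) (r j)) -> \det K = gram (r 0) (r 1).
Proof.
move=> KE; rewrite (expand_det_row _ 0) !big_ord_recl big_ord0 addr0 /cofactor.
rewrite !det_mx11 !mxE.
have -> : lift 0 0 = 1 :> 'I_2 by apply: val_inj.
have -> : lift 1 0 = 0 :> 'I_2 by apply: val_inj.
rewrite !KE /gram (dotC (r 1) (r 0)).
move: (dot (r 0) (r 0)) (dot (r 0) (r 1)) (dot (r 1) (r 1)) => p q s.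
by rewrite /= expr0 expr1 mul1r mulN1r mulrN expr2.
Qed.

(** The product of the Jacobian with its transpose is the Gram matrix of the partials; being
    invertible, it forces rank 2. *)
Lemma rank_jacobian (F : V2 -> V3) x : differentiable F x ->
  gram (partial F 0 x) (partial F 1 x) != 0 -> \rank ('J F x) = 2%N.
Proof.
move=> dF; have row_J i : partial F i x = row i ('J F x).
  by rewrite /partial deriveEjacobian // rowE.
move: (jacobian F x) row_J => J row_J g0.
have JJ i j : (J *m J^T) i j = dot (partial F i x) (partial F j x).
  by rewrite !mxE; apply: eq_bigr => l _; rewrite !row_J !mxE.
have JJu : J *m J^T \in unitmx.
  by rewrite unitmxE unitfE (det_gram JJ).
apply/eqP; rewrite eqn_leq rank_leq_row /=.
by have := mxrankM_maxl J J^T; rewrite (mxrank_unit JJu).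
Qed.

Lemma coord_le_enorm n (x : 'rV[R]_n) j : `|x 0 j| <= enorm x.
Proof.
rewrite -sqrtr_sqr ler_wsqrtr // /dot (bigD1 j) //= -expr2 lerDl.
by apply: sumr_ge0 => i _; rewrite -expr2 sqr_ge0.
Qed.

Lemma near_eball n (a : 'rV[R]_n) (P : set 'rV[R]_n) : (\forall y \near a, P y) ->
  exists2 r, 0 < r & eball a r `<=` P.
Proof.
move=> /nbhs_ballP[r /= r0 aP]; exists r => // x ax; apply: aP; split=> // i j.
rewrite -ball_normE /= (ord1 i) distrC.
have := coord_le_enorm (x - a) j; rewrite !mxE => /le_lt_trans; exact.
Qed.

Lemma continuous_dot (T : topologicalType) n (f g : T -> 'rV[R]_n) (t : T) :
  {for t, continuous f} -> {for t, continuous g} ->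
  {for t, continuous (fun s => dot (f s) (g s))}.
Proof.
move=> cf cg; rewrite /dot.
have -> : (fun s => \sum_i f s 0 i * g s 0 i) = \sum_i (fun s => f s 0 i * g s 0 i).
  by apply/funext => s; rewrite fct_sumE.
elim/big_ind: _ => [|u v cu cv|j _]; first exact: cst_continuous.
  exact: (cvgD cu cv).
exact: (cvgM (continuous_comp cf (@coord_continuous R _ _ 0 j (f t)))
             (continuous_comp cg (@coord_continuous R _ _ 0 j (g t)))).
Qed.

Lemma continuous_gram (f g : V2 -> V3) x :
  {for x, continuous f} -> {for x, continuous g} ->
  {for x, continuous (fun y => gram (f y) (g y))}.
Proof.
move=> cf cg; have cfg := continuous_dot cf cg.
rewrite /gram; apply: continuousB.
  exact: (cvgM (continuous_dot cf cf) (continuous_dot cg cg)).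
exact: (cvgM cfg cfg).
Qed.

Lemma Ck_continuous n k U (f : V2 -> 'rV[R]_n) x : Ck k U f -> U x ->
  {for x, continuous f}.
Proof.
case: k => [|k] /=; first by move=> cf; apply: cf.
by case=> df _ Ux; apply/differentiable_continuous/df.
Qed.

(** A global homeomorphism is cut down to a ball on which the nonzero Gram determinant persists by
    continuity. The image of the ball is written as a preimage under [rho'], so that its openness is
    the continuity of [rho']. *)
Lemma Gk_continuous_at k (q : V2 -> V3) (D U : set V2)
    (rho rho' : V2 -> V2) (a x : V2) :
  rho a = x ->
  continuous rho -> continuous rho' -> cancel rho rho' -> cancel rho' rho ->
  open D -> D x -> open U -> U a -> Ck k.+1 U (q \o rho) ->
  gram (partial (q \o rho) 0 a) (partial (q \o rho) 1 a) != 0 ->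
  exists (Dx : set V2) (a : V2) (r : R) (rho0 : V2 -> V2),
    [/\ open Dx, Dx x & Dx `<=` D] /\
    [/\ 0 < r, homeomorphism (eball a r) Dx rho0,
        Ck k.+1 (eball a r) (q \o rho0) & regular_on (eball a r) (q \o rho0)].
Proof.
move=> <- crho crho' rhoK rho'K oD Da oU Ua sF g0.
have [dF sF'] := sF.
have nU : \forall y \near a, U y by exact: open_nbhs_nbhs.
have nD : \forall y \near a, D (rho y).
  exact: (crho a D (open_nbhs_nbhs (conj oD Da))).
have ng : \forall y \near a,
    gram (partial (q \o rho) 0 y) (partial (q \o rho) 1 y) != 0.
  have := continuous_gram (Ck_continuous (sF' 0) Ua) (Ck_continuous (sF' 1) Ua).
  move=> /(_ [set t | t != 0]); apply; apply: open_nbhs_nbhs.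
  by split; [exact: open_neq|exact: g0].
have nP : \forall y \near a, [/\ U y, D (rho y) &
    gram (partial (q \o rho) 0 y) (partial (q \o rho) 1 y) != 0].
  by apply: filterS3 nU nD ng => y.
have [r r0 rP] := near_eball nP.
exists (rho' @^-1` eball a r), a, r, rho; split; split=> //.
- have ce : continuous (fun y => enorm (rho' y - a)).
    move=> y; rewrite /enorm.
    have cs : {for y, continuous (fun y => rho' y - a)}.
      by apply: continuousB; [exact: crho'|exact: cst_continuous].
    exact: (continuous_comp (continuous_dot cs cs) (@sqrt_continuous R _)).
  rewrite (_ : _ @^-1` _ = (fun y => enorm (rho' y - a)) @^-1` [set t | t < r]) //.
  by apply: open_comp; [move=> y _; exact: ce|exact: open_lt].
- rewrite /= rhoK /eball /= subrr /enorm.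
  have -> : dot (0 : V2) 0 = 0 by rewrite /dot big1 // => i _; rewrite mxE mul0r.
  by rewrite sqrtr0.
- by move=> y /rP[]; rewrite rho'K.
- split.
  + split=> [y|y z _ _|y].
    * by rewrite /= rhoK.
    * exact: can_inj rhoK y z.
    * by move=> By; exists (rho' y).
  + exact: continuous_subspaceT.
  + by exists rho'; [exact: continuous_subspaceT|].
- by apply: Ck_sub sF => y /rP[].
- move=> y /rP[Uy _ gy]; split; first exact: dF.
  by apply: rank_jacobian => //; exact: dF.
Qed.

End LocalParametrization.

(** * A patch glued to its mirror image *)

Section MirrorGluing.
Context {R : realType}.
Notation V2 := 'rV[R]_2.
Notation V3 := 'rV[R]_3.

(** [reflection a b] is the case where [n] is [cross a b]; the gluing argument needs only the
    normal. *)
Definition reflect_along (n v : V3) : V3 := v - (2 * dot v n / dot n n) *: n.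

Lemma reflect_alongE (n v : V3) j :
  reflect_along n v 0 j = v 0 j - (2 * (n 0 j / dot n n)) * dot v n.
Proof. by rewrite !mxE; ring. Qed.

Lemma gram_reflect (n a b : V3) (s t : R) : dot n n != 0 -> s ^+ 2 = 1 -> t ^+ 2 = 1 ->
  gram (s *: reflect_along n a) (t *: reflect_along n b) = gram a b.
Proof.
move=> nn s2 t2.
have dZ (u v : R) (x y : V3) : dot (u *: x) (v *: y) = u * v * dot x y.
  by rewrite !dot3E !mxE; ring.
have dR (x y : V3) : dot (reflect_along n x) (reflect_along n y) = dot x y.
  have E l m : dot (x - l *: n) (y - m *: n) =
      dot x y - m * dot x n - l * dot y n + l * m * dot n n.
    by rewrite !dot3E !mxE; ring.
  by rewrite /reflect_along E; field.
rewrite /gram !dZ !dR.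
have -> : s * s * dot a a * (t * t * dot b b) - (s * t * dot a b) ^+ 2 =
    s ^+ 2 * t ^+ 2 * (dot a a * dot b b - dot a b ^+ 2) by ring.
by rewrite s2 t2 !mul1r.
Qed.

Lemma gram_shear (a b : V3) (l : R) : gram (a - l *: b) b = gram a b.
Proof.
rewrite /gram.
have -> : dot (a - l *: b) (a - l *: b) = dot a a - 2 * l * dot a b + l * l * dot b b.
  by rewrite !dot3E !mxE; ring.
have -> : dot (a - l *: b) b = dot a b - l * dot b b by rewrite !dot3E !mxE; ring.
ring.
Qed.

Section Patch.
Variables (p : V2 -> V3) (n : V3).
Hypothesis polyp : forall j, polyfun (fun x => p x 0 j).
Hypothesis nn : dot n n != 0.

Let P j (x : V2) := p x 0 j.
Let q (x : V2) := dot (p x) n.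
Let F := Defs.glue p (reflect_along n \o p).

Lemma polyfun_q : polyfun q.
Proof.
rewrite (_ : q = fun x => n 0 0 * P 0 x + n 0 1 * P 1 x + n 0 2 * P 2 x).
  have pZ (c : R) j : polyfun (fun x => c * P j x) by apply: polyfunZ; exact: polyp.
  exact: (polyfunD (polyfunD (pZ _ _) (pZ _ _)) (pZ _ _)).
by apply/funext => x; rewrite /q dot3E /P; ring.
Qed.

Lemma differentiable_patch x : differentiable p x.
Proof. by apply: differentiable_row => j; apply: polyfun_differentiable. Qed.

Lemma partial_patch i x j : partial p i x 0 j = pd i (P j) x.
Proof. by rewrite (partial_coord _ _ (differentiable_patch x)). Qed.

Lemma pd_q i x : pd i q x = dot (partial p i x) n.
Proof.
have dP j : differentiable (P j) x := polyfun_differentiable x (polyp j).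
have dZ (c : R) j : differentiable (fun y => c * P j y) x.
  by apply: polyfun_differentiable; apply: polyfunZ; exact: polyp.
have -> : q = fun x => (n 0 0 * P 0 x + n 0 1 * P 1 x) + n 0 2 * P 2 x.
  by apply/funext => y; rewrite /q dot3E /P; ring.
rewrite (pdD _ (differentiableD (dZ _ _) (dZ _ _)) (dZ _ _)) (pdD _ (dZ _ _) (dZ _ _)).
rewrite (pdZ _ _ (dP 0)) (pdZ _ _ (dP 1)) (pdZ _ _ (dP 2)) dot3E !partial_patch.
by rewrite !(mulrC (pd _ _ _)).
Qed.

Lemma Ck_patch k U : open U -> Ck k U p.
Proof. by move=> oU; apply: Ck_coord => // j; apply: polyfun_smooth. Qed.

Let gfun x := gram (partial p 0 x) (partial p 1 x).

Lemma continuous_gfun x : {for x, continuous gfun}.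
Proof.
have [_ cp] := @Ck_patch 1 setT openT.
by apply: continuous_gram; [apply: (cp 0)|apply: (cp 1)].
Qed.

(** The absolute value makes the domain symmetric: left of the line the reflected patch is as
    regular as [p] is at the mirror point. *)
Definition regular_domain : set V2 := [set x | gfun (pt2 `|x 0 0| (x 0 1)) != 0].

Lemma open_regular_domain : open regular_domain.
Proof.
rewrite (_ : regular_domain =
  (fun x : V2 => gfun (pt2 `|x 0 0| (x 0 1))) @^-1` [set t | t != 0]) //.
apply: open_comp; last exact: open_neq.
move=> x _; apply: (@continuous_comp _ _ _ (fun x : V2 => pt2 `|x 0 0| (x 0 1)) gfun).
  apply: pt2_continuous; last exact: coord_continuous.
  exact: (cvg_norm (@coord_continuous R _ _ 0 0 x)).
exact: continuous_gfun.
Qed.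

(** Off the line the glued map is locally a single polynomial map, so the identity serves as
    chart. *)
Lemma Gk_at_pos (x : V2) : 0 < x 0 0 -> regular_domain x ->
  exists (Dx : set V2) (a : V2) (r : R) (rho0 : V2 -> V2),
    [/\ open Dx, Dx x & Dx `<=` regular_domain] /\
    [/\ 0 < r, homeomorphism (eball a r) Dx rho0,
        Ck 2 (eball a r) (F \o rho0) & regular_on (eball a r) (F \o rho0)].
Proof.
move=> x0 Dx; have oH : open [set y : V2 | 0 < y 0 0].
  move=> y y0; exact: near_coord_gt0 y0.
have FE : {in [set y : V2 | 0 < y 0 0], p =1 F}.
  by move=> y /set_mem /= y0; rewrite /F /Defs.glue ltW.
have CF : Ck 2 [set y : V2 | 0 < y 0 0] (F \o id) := Ck_eq oH FE (Ck_patch 2 oH).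
have E i : partial (F \o id) i x = partial p i x.
  by apply: near_eq_derive; have := eq_on_near oH FE x0; apply: filterS => y ->.
have g0 : gram (partial (F \o id) 0 x) (partial (F \o id) 1 x) != 0.
  rewrite (congr2 gram (E 0) (E 1)).
  have xE : pt2 `|x 0 0| (x 0 1) = x by rewrite (gtr0_norm x0) pt2_eta.
  have := Dx : gfun (pt2 `|x 0 0| (x 0 1)) != 0; rewrite xE; exact.
have cid : continuous (id : V2 -> V2) by move=> y; exact: cvg_id.
exact: (@Gk_continuous_at _ 1 F regular_domain _ id id x x erefl cid cid
  (fun _ => erefl) (fun _ => erefl) open_regular_domain Dx oH x0 CF g0).
Qed.

(** Again the identity chart; the reflection is an isometry and the signs produced by [mirror]
    square to one, so the Gram determinant is that of [p] at the mirror point. *)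
Lemma Gk_at_neg (x : V2) : x 0 0 < 0 -> regular_domain x ->
  exists (Dx : set V2) (a : V2) (r : R) (rho0 : V2 -> V2),
    [/\ open Dx, Dx x & Dx `<=` regular_domain] /\
    [/\ 0 < r, homeomorphism (eball a r) Dx rho0,
        Ck 2 (eball a r) (F \o rho0) & regular_on (eball a r) (F \o rho0)].
Proof.
move=> x0 Dx; set H := [set y : V2 | y 0 0 < 0].
have oH : open H by move=> y y0; exact: near_coord_lt0 y0.
pose G y := reflect_along n (p (mirror y)).
have FE : {in H, G =1 F}.
  by move=> y /set_mem /= y0; rewrite /F /Defs.glue leNgt y0.
pose g0 j y := P j y - (2 * (n 0 j / dot n n)) * q y.
have pg0 j : polyfun (g0 j).
  by apply: polyfunB; [exact: polyp|apply: polyfunZ; exact: polyfun_q].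
have GE j : (fun y => G y 0 j) = (fun y => g0 j (mirror y)).
  by apply/funext => y; rewrite /G reflect_alongE.
have CG : Ck 2 setT G.
  apply: Ck_coord => [|j]; first exact: openT.
  rewrite GE; apply: smooth_mirror => //; first exact: openT.
  by apply: polyfun_smooth => //; exact: openT.
have dG y : differentiable G y by have [d _] := CG; apply: d.
have pG i y : partial G i y = msign i *: reflect_along n (partial p i (mirror y)).
  apply/rowP => j; rewrite (partial_coord _ _ (dG y)) GE.
  rewrite pd_mirror; last exact: polyfun_differentiable.
  rewrite (pd_subZ _ _ (polyfun_differentiable _ (polyp j))
    (polyfun_differentiable _ polyfun_q)).
  by rewrite [RHS]mxE reflect_alongE pd_q partial_patch.
have CF : Ck 2 H (F \o id) := Ck_eq oH FE (Ck_sub (@subsetT _ H) CG).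
have E i : partial (F \o id) i x = partial G i x.
  by apply: near_eq_derive; have := eq_on_near oH FE x0; apply: filterS => y ->.
have g0' : gram (partial (F \o id) 0 x) (partial (F \o id) 1 x) != 0.
  rewrite (congr2 gram (etrans (E 0) (pG 0 x)) (etrans (E 1) (pG 1 x))).
  have m0 : msign 0 ^+ 2 = 1 :> R by rewrite /msign /= sqrrN expr1n.
  have m1 : msign 1 ^+ 2 = 1 :> R by rewrite /msign /= expr1n.
  rewrite (gram_reflect _ _ nn m0 m1).
  have xE : pt2 `|x 0 0| (x 0 1) = mirror x by rewrite (ltr0_norm x0).
  have := Dx : gfun (pt2 `|x 0 0| (x 0 1)) != 0; rewrite xE; exact.
have cid : continuous (id : V2 -> V2) by move=> y; exact: cvg_id.
exact: (@Gk_continuous_at _ 1 F regular_domain _ id id x x erefl cid cid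
  (fun _ => erefl) (fun _ => erefl) open_regular_domain Dx oH x0 CF g0').
Qed.

End Patch.
End MirrorGluing.

(** * Points on the common boundary line *)

Section MirrorGluingLine.
Context {R : realType}.
Notation V2 := 'rV[R]_2.
Notation V3 := 'rV[R]_3.
Variables (p : V2 -> V3) (n : V3).
Hypothesis polyp : forall j, polyfun (fun x => p x 0 j).
Hypothesis nn : dot n n != 0.
Hypothesis pn : forall t, dot (p (pt2 0 t)) n = 0.
Hypothesis det0 : forall t, dot (patch_normal p (pt2 0 t)) n = 0.

Let P j (x : V2) := p x 0 j.
Let q (x : V2) := dot (p x) n.
Let F := Defs.glue p (reflect_along n \o p).

Lemma polyfun_dot (f g : V2 -> V3) : (forall j, polyfun (fun x => f x 0 j)) ->
  (forall j, polyfun (fun x => g x 0 j)) -> polyfun (fun x => dot (f x) (g x)).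
Proof.
by move=> pf pg; apply: polyfun_sum => j; apply: polyfunM.
Qed.

Lemma polyfun_partial i j : polyfun (fun x => partial p i x 0 j).
Proof.
rewrite (_ : (fun _ => _) = pd i (P j)); first exact/polyfun_pd/polyp.
by apply/funext => x; apply: partial_patch.
Qed.

Let vv x := dot (partial p 1 x) (partial p 1 x).
Let uv x := dot (partial p 0 x) (partial p 1 x).
(** The coefficient of the orthogonal projection of [p_u] on [p_v]; subtracting it leaves a multiple
    of [n] on the line. *)
Let B x := uv x / vv x.
(** The solution of the equation that annihilates the second normal derivative in [pd_reparam] for
    [q]; the terms in [pd 1 q] and [pd 1 (pd 1 q)] are absent because [q] vanishes on the line. *)
Let M x := - ((pd 0 (pd 0 q) x - B x * (pd 1 (pd 0 q) x + pd 0 (pd 1 q) x)) /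
              (2 * pd 0 q x)).
Let W := [set x | vv x * pd 0 q x != 0].

Let pq : polyfun q := polyfun_q n polyp.

Let polyW : polyfun (fun x => vv x * pd 0 q x).
Proof.
by apply: polyfunM (polyfun_pd 0 pq); apply: polyfun_dot => j; exact: polyfun_partial.
Qed.

Let oW : open W.
Proof.
apply: (@open_comp _ _ (fun x => vv x * pd 0 q x) [set t | t != 0]);
  last exact: open_neq.
by move=> x _; apply: polyfun_continuous polyW x.
Qed.

Let W1 x : W x -> vv x != 0.
Proof. by rewrite /W /= mulf_eq0 negb_or => /andP[]. Qed.

Let W2 x : W x -> pd 0 q x != 0.
Proof. by rewrite /W /= mulf_eq0 negb_or => /andP[]. Qed.

Lemma smooth_B k : smooth k W B.
Proof.
apply: (smoothM oW).
  by apply: (polyfun_smooth k oW); apply: polyfun_dot => j; exact: polyfun_partial.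
apply: (smoothV oW W1).
by apply: (polyfun_smooth k oW); apply: polyfun_dot => j; exact: polyfun_partial.
Qed.

Lemma smooth_M k : smooth k W M.
Proof.
have s i j : smooth k W (pd i (pd j q)).
  by apply: (polyfun_smooth k oW); exact: (polyfun_pd i (polyfun_pd j pq)).
have s2 : smooth k W (fun x => 2 * pd 0 q x).
  by apply: (polyfun_smooth k oW); exact: (polyfunZ 2 (polyfun_pd 0 pq)).
apply: (smoothN oW); apply: (smoothM oW).
  exact: (smoothB oW (s 0 0) (smoothM oW (smooth_B k) (smoothD oW (s 1 0) (s 0 1)))).
apply: (smoothV oW) s2 => x Wx; rewrite mulf_neq0 ?pnatr_eq0 //; exact: W2.
Qed.

(** The coefficients are read off at the foot [pt2 0 (x 0 1)], so the domain is a cylinder over part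
    of the line, stable under [mirror]. *)
Let U := [set x : V2 | W (pt2 0 (x 0 1))].

Let oU : open U.
Proof.
apply: (@open_comp _ _ (fun x : V2 => pt2 0 (x 0 1)) W); last exact: oW.
move=> x _; apply: pt2_continuous; first exact: cst_continuous.
exact: coord_continuous.
Qed.

Let mU x : U x -> U (mirror x).
Proof. by rewrite /U /= pt2_1. Qed.

Lemma smooth_line_param k (f : V2 -> R) : smooth k W f ->
  smooth k U (fun x => f (pt2 0 (x 0 1))).
Proof.
move=> sf; apply: (smooth_comp oU _ sf) => [x //||].
  exact: smooth_cst.
exact: smooth_coord.
Qed.

Lemma pd0_line_param (f : V2 -> R) (x : V2) : smooth 1 W f -> U x ->
  pd 0 (fun x => f (pt2 0 (x 0 1))) x = 0.
Proof.
move=> [df _] Ux.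
rewrite (pd_comp _ (differentiable_cst _ _) (differentiable_coord _ _ _) (df _ Ux)).
by rewrite pd_cst pd0_coord1 !mul0r addr0.
Qed.

(** Constant across the line, hence with zero [pd 0], as [pd_reparam] requires. *)
Let M' (x : V2) := M (pt2 0 (x 0 1)).
Let B' (x : V2) := B (pt2 0 (x 0 1)).
Let r0 (x : V2) := x 0 0 + M' x * (x 0 0 * x 0 0).
Let r1 (x : V2) := x 0 1 - B' x * r0 x.
Let f j (x : V2) := P j (pt2 (r0 x) (r1 x)).
Let h (x : V2) := q (pt2 (r0 x) (r1 x)).

Lemma line_eta (x : V2) : x 0 0 = 0 -> pt2 0 (x 0 1) = x.
Proof. by move=> x0; rewrite -[RHS]pt2_eta x0. Qed.

Lemma pd1_q (x : V2) : x 0 0 = 0 -> pd 1 q x = 0.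
Proof.
apply: (@pd1_line _ setT q openT) => // [y _|y _ y0].
  exact: polyfun_differentiable pq.
by rewrite -(line_eta y0); exact: pn.
Qed.

Lemma pd11_q (x : V2) : x 0 0 = 0 -> pd 1 (pd 1 q) x = 0.
Proof.
apply: (@pd1_line _ setT (pd 1 q) openT) => // [y _|y _ y0].
  exact: polyfun_differentiable (polyfun_pd 1 pq).
exact: pd1_q.
Qed.

Lemma reparam_patch (g : V2 -> R) : polyfun g ->
  smooth 2 U (fun x => g (pt2 (r0 x) (r1 x))) /\
  forall x : V2, U x -> x 0 0 = 0 ->
  [/\ g (pt2 (r0 x) (r1 x)) = g x, pd 1 (fun x => g (pt2 (r0 x) (r1 x))) x = pd 1 g x,
      pd 0 (fun x => g (pt2 (r0 x) (r1 x))) x = pd 0 g x - B x * pd 1 g x &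
      pd 0 (pd 0 (fun x => g (pt2 (r0 x) (r1 x)))) x =
        2 * M x * (pd 0 g x - B x * pd 1 g x) +
        (pd 0 (pd 0 g) x - B x * pd 1 (pd 0 g) x) -
        B x * (pd 0 (pd 1 g) x - B x * pd 1 (pd 1 g) x)].
Proof.
move=> pg; have [sF H] := @pd_reparam R U M' B' g oU
  (smooth_line_param (smooth_M 2)) (smooth_line_param (smooth_B 2))
  (fun x Ux => pd0_line_param (smooth_M 1) Ux)
  (fun x Ux => pd0_line_param (smooth_B 1) Ux) (polyfun_smooth 2 openT pg).
split=> [|x Ux x0]; first exact: sF.
have EM : M' x = M x := congr1 M (line_eta x0).
have EB : B' x = B x := congr1 B (line_eta x0).
have [a1 a2 a3 a4] := H x Ux x0; rewrite -EM -EB.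
by split; [exact: a1|exact: a2|exact: a3|exact: a4].
Qed.

(** These are the hypotheses of [smooth_sglue_reflection] with [c] equal to [n 0 j / dot n n]. They
    come from the curve lying in the mirror plane, from [tangent_decomposition], and from the choice
    of [M]. *)
Lemma reparam_line j (x : V2) : U x -> x 0 0 = 0 ->
  [/\ h x = 0, pd 0 (f j) x = n 0 j / dot n n * pd 0 h x & pd 0 (pd 0 h) x = 0].
Proof.
move=> Ux x0; have [_ Hq] := reparam_patch pq; have [_ Hf] := reparam_patch (polyp j).
have [h1 _ h2 h3] := Hq x Ux x0; have [_ _ f2 _] := Hf x Ux x0.
have Wx : W x by have := Ux; rewrite /U /= (line_eta x0).
have q0 := W2 Wx; split.
- by rewrite /h h1 -(line_eta x0); exact: pn.
- rewrite [LHS]f2 [pd 0 h x]h2 (pd1_q x0) mulr0 subr0 /B /uv /vv.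
  rewrite -(partial_patch polyp) -(partial_patch polyp) (pd_q n polyp).
  apply: tangent_decomposition => //; last exact: W1.
    by rewrite -(pd_q n polyp); exact: pd1_q.
  by rewrite -(line_eta x0); exact: det0.
rewrite [LHS]h3 (pd1_q x0) (pd11_q x0) mulr0 subr0 /M.
move: q0; move: (pd 0 q x) (pd 0 (pd 0 q) x) (pd 1 (pd 0 q) x) (pd 0 (pd 1 q) x) (B x).
by move=> a b c d e a0; field.
Qed.

Let G j (y : V2) := f j (mirror y) - (2 * (n 0 j / dot n n)) * h (mirror y).

Lemma smooth_glued j : smooth 2 U (sglue (f j) (G j)) /\
  forall (x : V2) i, U x -> x 0 0 = 0 -> pd i (sglue (f j) (G j)) x = pd i (f j) x.
Proof.
have [sf _] := reparam_patch (polyp j); have [sh _] := reparam_patch pq.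
exact: (smooth_sglue_reflection oU mU sf sh (@reparam_line j)).
Qed.

(* For [x 0 0 < 0] the reparametrization is the mirror image of
   [(r0, r1)] at [mirror x]. *)
Lemma glued_coord (x y : V2) j :
  `|M' x| * `|x 0 0| <= 1 / 2 ->
  let u := x 0 0 + M' x * (x 0 0 * `|x 0 0|) in
  y = pt2 u (x 0 1 - B' x * `|u|) -> F y 0 j = sglue (f j) (G j) x.
Proof.
move=> Mx u ->; have Ms : `|M' x * x 0 0| <= 1 / 2 by rewrite normrM.
move: Ms; rewrite ler_norml => /andP[Ms1 Ms2].
rewrite /F /Defs.glue pt2_0 /sglue; have [x0|x0] := leP 0 (x 0 0).
  have uE : u = r0 x by rewrite /u /r0 ger0_norm.
  (* The bound [1 / 2] on [M' x * x 0 0] keeps [u] on the same side as [x 0 0], so [glue] and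
     [sglue] select corresponding branches. *)
  have u0 : 0 <= u.
    have -> : u = x 0 0 * (1 + M' x * x 0 0) by rewrite /u ger0_norm //; ring.
    by rewrite mulr_ge0 //; lra.
  by rewrite u0 (ger0_norm u0) uE.
have uE : - u = r0 (mirror x).
  by rewrite /u /r0 /M' /mirror !pt2_0 !pt2_1 ltr0_norm //; ring.
have u0 : u < 0.
  have -> : u = x 0 0 * (1 - M' x * x 0 0) by rewrite /u ltr0_norm //; ring.
  by rewrite nmulr_rlt0 //; lra.
rewrite leNgt u0 /= (ltr0_norm u0) reflect_alongE.
have -> : mirror (pt2 u (x 0 1 - B' x * - u)) = pt2 (r0 (mirror x)) (r1 (mirror x)).
  by rewrite {1}/mirror pt2_0 pt2_1 uE /r1 /B' /mirror !pt2_1.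
by [].
Qed.

Lemma Gk_at_line (x : V2) : x 0 0 = 0 -> regular_domain p x ->
  exists (Dx : set V2) (a : V2) (r : R) (rho0 : V2 -> V2),
    [/\ open Dx, Dx x & Dx `<=` regular_domain p] /\
    [/\ 0 < r, homeomorphism (eball a r) Dx rho0,
        Ck 2 (eball a r) (F \o rho0) & regular_on (eball a r) (F \o rho0)].
Proof.
move=> x0 Dx; have xE := line_eta x0.
have gx : gram (partial p 0 x) (partial p 1 x) != 0.
  have E : pt2 `|x 0 0| (x 0 1) = x by rewrite x0 normr0.
  have := Dx : gram (partial p 0 (pt2 `|x 0 0| (x 0 1)))
    (partial p 1 (pt2 `|x 0 0| (x 0 1))) != 0.
  by rewrite E.
have bn : dot (partial p 1 x) n = 0 by rewrite -(pd_q n polyp); exact: pd1_q.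
have dn : dot (cross (partial p 0 x) (partial p 1 x)) n = 0.
  by rewrite -xE; exact: det0.
(* Regularity and the boundary condition together make both denominators nonzero at [x]. *)
have [v0 q0] := transversal_of_gram nn bn dn gx.
have Wx : W x by rewrite /W /= mulf_neq0 // (pd_q n polyp).
have Ux : U x by rewrite /U /= xE.
have lip g : smooth 1 W g -> exists e L : R, [/\ 0 < e, 0 < L &
    forall a b, `|a| <= e -> `|b| <= e ->
    `|g (pt2 0 (x 0 1 + a)) - g (pt2 0 (x 0 1 + b))| <= L * `|a - b|].
  move=> [dg sg].
  have [e [L [e0 L0 H]]] := C1_lipschitz_line oW Wx dg (sg 1 x Wx).
  exists e, L; split=> // a b ae be; have [_] := H a b ae be.
  have E c : x + c *: delta_mx 0 1 = pt2 0 (x 0 1 + c).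
    by rewrite -{1}xE !pt2E !scale0r !add0r scalerDl.
  by rewrite !E.
have [e1 [L1 [e10 L10 H1]]] := lip B (smooth_B 1).
have [e2 [L2 [e20 L20 H2]]] := lip M (smooth_M 1).
pose e := Num.min e1 e2; pose L := L1 + L2.
have [|||| rho [rho' [crho crho' rhoK rho'K [r rp H]]]] :=
  @piecewise_shear_homeomorphism R (fun t => B (pt2 0 t))
    (fun t => M (pt2 0 t)) (x 0 1) e L.
- by rewrite lt_min e10.
- exact: addr_gt0.
- move=> a b; rewrite !le_min => /andP[a1 _] /andP[b1 _].
  by rewrite (le_trans (H1 a b a1 b1)) // ler_wpM2r // lerDl ltW.
- move=> a b; rewrite !le_min => /andP[_ a2] /andP[_ b2].
  by rewrite (le_trans (H2 a b a2 b2)) // ler_wpM2r // lerDr ltW.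
pose N1 := [set y : V2 | `|y 0 0| < r]; pose N2 := [set y : V2 | `|y 0 1 - x 0 1| < r].
have oN1 : open N1.
  apply: (@open_comp _ _ (fun y : V2 => `|y 0 0|) [set t | t < r]);
    last exact: open_lt.
  by move=> y _; exact: (cvg_norm (@coord_continuous R _ _ 0 0 y)).
have oN2 : open N2.
  apply: (@open_comp _ _ (fun y : V2 => `|y 0 1 - x 0 1|) [set t | t < r]);
    last exact: open_lt.
  move=> y _; have c : {for y, continuous (fun y : V2 => y 0 1 - x 0 1)}.
    by apply: continuousB; [exact: coord_continuous|exact: cst_continuous].
  exact: (cvg_norm c).
pose N := U `&` (N1 `&` N2).
have oN : open N by apply: openI => //; apply: openI.
have Nx1 : `|x 0 0| < r by rewrite x0 normr0.
have Nx2 : `|x 0 1 - x 0 1| < r by rewrite subrr normr0.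
have Nx : N x by [].
have FE j : {in N, sglue (f j) (G j) =1 (fun y => (F \o rho) y 0 j)}.
  move=> y /set_mem [_ [/= y1 y2]]; have [A1 A2] := H y (ltW y1) (ltW y2).
  by rewrite -(glued_coord j A1 A2).
have rx : rho x = x.
  have := H x; rewrite x0 subrr normr0 => /(_ (ltW rp) (ltW rp))[_ ->].
  by rewrite !(mul0r, mulr0) addr0 normr0 mulr0 subr0 xE.
have sN j : smooth 2 N (sglue (f j) (G j)).
  by apply: smooth_sub (proj1 (smooth_glued j)) => y [].
have CF : Ck 2 N (F \o rho) :=
  Ck_coord oN (fun j => smooth_eq oN (FE j) (sN j)).
have dF : differentiable (F \o rho) x by have [d _] := CF; apply: d.
have pF i j : partial (F \o rho) i x 0 j = pd i (f j) x.
  rewrite (partial_coord _ _ dF) -(proj2 (smooth_glued j) x i Ux x0).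
  by apply/esym/pd_near/(eq_on_near oN (FE j) Nx).
(* At [x] the partials of the composite are those of [p] up to the shear by [B x], which leaves the
   Gram determinant unchanged. *)
have p0 : partial (F \o rho) 0 x = partial p 0 x - B x *: partial p 1 x.
  apply/rowP => j; have [_ Hf] := reparam_patch (polyp j).
  have [_ _ f2 _] := Hf x Ux x0.
  by rewrite (pF 0 j) [LHS]f2 !mxE !(partial_patch polyp).
have p1 : partial (F \o rho) 1 x = partial p 1 x.
  apply/rowP => j; have [_ Hf] := reparam_patch (polyp j).
  have [_ f2 _ _] := Hf x Ux x0.
  by rewrite (pF 1 j) [LHS]f2 (partial_patch polyp).
have g0 : gram (partial (F \o rho) 0 x) (partial (F \o rho) 1 x) != 0.
  by rewrite (congr2 gram p0 p1) gram_shear.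
exact: (Gk_continuous_at rx crho crho' rhoK rho'K
  (open_regular_domain polyp) Dx oN Nx CF g0).
Qed.

End MirrorGluingLine.

(** * Quartic patches *)

Section MirrorSpline.
Context {R : realType}.
Notation V2 := 'rV[R]_2.
Notation V3 := 'rV[R]_3.

Lemma polyfun_normal (p : V2 -> V3) (n : V3) :
  (forall j, polyfun (fun x => p x 0 j)) ->
  polyfun (fun x => dot (patch_normal p x) n).
Proof.
move=> pp; have pd i j : polyfun (fun x => partial p i x 0 j) := polyfun_partial pp i j.
have pB i j k l : polyfun (fun x => partial p 0 x 0 i * partial p 1 x 0 j -
    partial p 0 x 0 k * partial p 1 x 0 l).
  by apply: polyfunB; apply: polyfunM.
have pZ (c : R) f : polyfun f -> polyfun (fun x => f x * c).
  by move=> pf; apply: polyfunM => //; exact: polyfun_cst.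
rewrite (_ : (fun _ => _) = fun x =>
  (partial p 0 x 0 1 * partial p 1 x 0 2 - partial p 0 x 0 2 * partial p 1 x 0 1)
     * n 0 0 +
  (partial p 0 x 0 2 * partial p 1 x 0 0 - partial p 0 x 0 0 * partial p 1 x 0 2)
     * n 0 1 +
  (partial p 0 x 0 0 * partial p 1 x 0 1 - partial p 0 x 0 1 * partial p 1 x 0 0)
     * n 0 2).
  exact: (polyfunD (polyfunD (pZ _ _ (pB _ _ _ _)) (pZ _ _ (pB _ _ _ _)))
    (pZ _ _ (pB _ _ _ _))).
by apply/funext => x; rewrite dot3E /patch_normal /cross !pt3E.
Qed.

Lemma mirror_spline_G2 (p : V2 -> V3) (n : V3) :
  (forall j, polyfun (fun x => p x 0 j)) -> dot n n != 0 ->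
  (forall t, dot (p (pt2 0 t)) n = 0) -> regular_patch p ->
  (forall t, 0 <= t <= 1 -> dot (patch_normal p (pt2 0 t)) n = 0) ->
  Gk_spline_patch 2 p (reflect_along n \o p).
Proof.
move=> pp nn pn rp det01.
(* The open domain also contains points of the line beyond the boundary segment, and charts are
   built there too. *)
have det0 : forall t, dot (patch_normal p (pt2 0 t)) n = 0.
  exact: (polyfun_line_eq0 (polyfun_normal n pp) det01).
split=> [v _|].
  by rewrite /= /reflect_along pn mulr0 mul0r scale0r subr0.
exists (regular_domain p); split; first exact: open_regular_domain.
  have gD x : Delta x -> gram (partial p 0 x) (partial p 1 x) != 0.
    by move=> /rp; exact: free_gram.
  move=> x [Dx|[z Dz <-]].
    have [/andP[x0 _] _ _] := Dx; have := gD x Dx.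
    have E : pt2 `|x 0 0| (x 0 1) = x by rewrite (ger0_norm x0) pt2_eta.
    by rewrite -{1 2}E.
  have [/andP[z0 _] _ _] := Dz; have := gD z Dz.
  have E : pt2 `|mirror z 0 0| (mirror z 0 1) = z.
    by rewrite pt2_0 pt2_1 normrN (ger0_norm z0) pt2_eta.
  by rewrite -{1 2}E.
move=> x Dx; have [x0|x0|x0] := ltgtP 0 (x 0 0).
- exact: Gk_at_pos.
- exact: Gk_at_neg.
- exact: Gk_at_line.
Qed.

Lemma dotDl (x y n : V3) : dot (x + y) n = dot x n + dot y n.
Proof. by rewrite !dot3E !mxE; ring. Qed.

Lemma dotZl (l : R) (x n : V3) : dot (l *: x) n = l * dot x n.
Proof. by rewrite !dot3E !mxE; ring. Qed.

Lemma dot0l (n : V3) : dot 0 n = 0.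
Proof. by rewrite !dot3E !mxE; ring. Qed.

Lemma dot_cross_l (x y : V3) : dot x (cross x y) = 0.
Proof. by rewrite !dot3E /cross !pt3E; ring. Qed.

Lemma dot_cross_r (x y : V3) : dot y (cross x y) = 0.
Proof. by rewrite !dot3E /cross !pt3E; ring. Qed.

Lemma in_plane_dot (a b x : V3) : in_plane a b x -> dot x (cross a b) = 0.
Proof.
by case=> l [m ->]; rewrite dotDl !dotZl dot_cross_l dot_cross_r !mulr0 addr0.
Qed.

Lemma polyfun_quartic c (alpha beta gamma zeta xi : R) j :
  polyfun (fun x => quartic_patch c alpha beta gamma zeta xi x 0 j).
Proof.
rewrite (_ : (fun _ => _) = fun x : V2 => \sum_(i < 5) \sum_(l < 5 | (i + l <= 4)%N)
  (4`!%:R / (i`! * l`! * (4 - i - l)`!)%:R * x 0 0 ^+ i * x 0 1 ^+ l *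
   (1 - x 0 0 - x 0 1) ^+ (4 - i - l)) *
  control_point c alpha beta gamma zeta xi i l (4 - i - l) 0 j).
  apply: polyfun_sum => i; apply: polyfun_sum => l.
  apply: polyfunM; last exact: polyfun_cst.
  apply: polyfunM.
    apply: polyfunM; first apply: polyfunM.
    - exact: polyfun_cst.
    - by apply: polyfunX; exact: polyfun_coord.
    - by apply: polyfunX; exact: polyfun_coord.
  apply: polyfunX; apply: polyfunB; last exact: polyfun_coord.
  by apply: polyfunB; [exact: polyfun_cst|exact: polyfun_coord].
apply/funext => x; rewrite /quartic_patch summxE; apply: eq_bigr => i _.
by rewrite summxE; apply: eq_bigr => l _; rewrite mxE.
Qed.

(** At [u = 0] only terms with [i = 0] survive, and their control points are combinations of
    [vertex1 c] and [vertex2 c]. *)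
Lemma quartic_boundary_plane c (alpha beta gamma zeta xi t : R) :
  dot (quartic_patch c alpha beta gamma zeta xi (pt2 0 t))
      (cross (vertex1 c) (vertex2 c)) = 0.
Proof.
set n := cross _ _.
have n1 : dot (vertex1 c) n = 0 by exact: dot_cross_l.
have n2 : dot (vertex2 c) n = 0 by exact: dot_cross_r.
have dot_sum := big_morph (fun x => dot x n) (fun x y => dotDl x y n) (dot0l n).
rewrite /quartic_patch dot_sum; apply: big1 => i _; rewrite dot_sum.
apply: big1 => l il; rewrite dotZl pt2_0.
have [i0|i0] := posnP i; last by rewrite expr0n eqn0Ngt i0 mulr0 !mul0r.
rewrite (_ : dot _ n = 0) ?mulr0 //.
rewrite i0 subn0; case: l il => [[|[|[|[|[|//]]]]] lt] _ /=; rewrite /control_point /=.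
- exact: n2.
- by rewrite dotDl !dotZl n1 n2 !mulr0 addr0.
- by rewrite dotZl dotDl n1 n2 addr0 mulr0.
- by rewrite dotDl !dotZl n1 n2 !mulr0 addr0.
- exact: n1.
Qed.

(** The third coordinate of the cross product is [Num.sqrt 3 / 2 * c ^+ 2]. *)
Lemma cross_vertices_neq0 (c : R) : c != 0 ->
  dot (cross (vertex1 c) (vertex2 c)) (cross (vertex1 c) (vertex2 c)) != 0.
Proof.
move=> c0; apply/eqP => /dot_eq0 /rowP /(_ 2).
rewrite /cross /vertex1 /vertex2 !pt3E mxE.
have -> : - (1 / 2) * c * (- (Num.sqrt 3 / 2) * c) - Num.sqrt 3 / 2 * c * (- (1 / 2) * c)
  = Num.sqrt 3 / 2 * c ^+ 2 by field.
by apply/eqP; rewrite !mulf_neq0 ?sqrf_eq0 ?expf_neq0 ?invr_eq0 ?pnatr_eq0 //.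
Qed.

Lemma radius_neq0 (c : R) : c = 2 * Num.sqrt 2 / 3 \/ c = Num.sqrt 6 / 3 \/
    c = Num.sqrt (2 * (5 - Num.sqrt 5) / 15) -> c != 0.
Proof.
have s5 : 0 < 5 - Num.sqrt 5 :> R.
  have := sqrtr_ge0 (5 : R); have := @sqr_sqrtr R 5 (ler0n _ _); nra.
move=> H; apply: lt0r_neq0; case: H => [->|[->|->]].
- by rewrite divr_gt0 // mulr_gt0 // sqrtr_gt0.
- by rewrite divr_gt0 // sqrtr_gt0.
- by rewrite sqrtr_gt0 divr_gt0 // mulr_gt0.
Qed.

End MirrorSpline.

Theorem mainTheorem8 (R : realType) (c : R) (p1 : 'rV[R]_2 -> 'rV[R]_3)
  (hc : c = 2 * Num.sqrt 2 / 3 \/ c = Num.sqrt 6 / 3 \/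
        c = Num.sqrt (2 * (5 - Num.sqrt 5) / 15))
  (hp1 : best_G1_patch c simplified_radial_error p1 \/
         best_G1_patch c radial_error p1) :
  Gk_spline_patch 2 p1 (reflection (vertex1 c) (vertex2 c) \o p1).
Proof.
have [[al [be [ga [ze [xi p1E]]]]] [reg _ bd]] :
    is_quartic_patch c p1 /\ G1_admissible c p1 by case: hp1 => -[].
apply: mirror_spline_G2 => //.
- by move=> j; rewrite p1E; exact: polyfun_quartic.
- exact/cross_vertices_neq0/radius_neq0.
- by move=> t; rewrite p1E; exact: quartic_boundary_plane.
(* The third of the boundary conditions is the one on [u = 0]. *)
- by move=> t /bd[_ _ +]; exact: in_plane_dot.
Qed.
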